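(* Assume $n\ne1$ and $0<\alpha_1\le\alpha_2\le\cdots\le\alpha_{n-1}\le\alpha_n<1$. Let $u$ be the (sufficiently smooth) exact solution of the multi-term Caputo-Fabrizio time-fractional diffusion problem described in the context, $u^k(x)=u(x,t_k)$, and for each integer $N_T\ge1$ let $\{u^k\}_{k=0}^{N_T}$ be the solution of the semi-discretized problem described in the context with initial condition $u^0:=u^0(x)$. Then there exists a constant $\widetilde c>0$, independent of $x$, $k$ and $N_T$ (equivalently, of $\Delta t$), such that for every integer $N_T\ge1$ and all $k=1,2,\dots,N_T$, $$|\widetilde R_k(x)|\le\widetilde c\,(\Delta t)^2\quad\text{for all }x\in\Lambda,$$ and the following error estimate holds with this same constant: $$\|u^k(x)-u^k\|_1\le\widetilde c\,S\exp\left(\frac{\alpha_nT}{1-\alpha_n}\right)(\Delta t)^2,\qquad k=1,2,\dots,N_T,$$ where $S$ is the length of $\Lambda$.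
   Context: Let $T,S>0$, $\Lambda=(0,S)$, $n\in\mathbb N$ with $n\ge1$, and $d_i\ge0$ ($i=1,\dots,n$), not all zero. The continuous problem is $$\sum_{i=1}^n d_i\,{}_0^{\mathrm{CF}}D_t^{\alpha_i}u(x,t)=\frac{\partial^2u(x,t)}{\partial x^2}+f(x,t),\quad (x,t)\in\Lambda\times(0,T],$$ $$u(x,0)=\varphi(x)\ (x\in\Lambda),\qquad u(0,t)=u(S,t)=0\ (t\in[0,T]),$$ with $\varphi,f$ given sufficiently smooth functions, where $${}_0^{\mathrm{CF}}D_t^{\alpha}u(x,t)=\frac{1}{1-\alpha}\int_0^t\frac{\partial u(x,s)}{\partial s}\exp\left(-\alpha\frac{t-s}{1-\alpha}\right)\mathrm{d}s .$$ ''Sufficiently smooth'' for $u$ means: $u(x,\cdot)\in C^2[0,T]$ for every $x\in\Lambda$ with $\partial_t^2u$ bounded on $\Lambda\times[0,T]$, and $u(\cdot,t)\in H^2(\Lambda)\cap H_0^1(\Lambda)$ for every $t\in[0,T]$. For an integer $N_T\ge1$ put $\Delta t=T/N_T$, $t_k=k\Delta t$, $f^k=f(\cdot,t_k)$. The notation $u^k(x)$ is used for the exact solution $u(x,t_k)$ and $u^k$ (without argument) for the semi-discrete solution. Coefficients: $\sigma_{j,k}^{(\alpha_i)}=\exp\left(-\alpha_i\frac{t_k-t_j}{1-\alpha_i}\right)$ for $0\le j\le k\le N_T$, and for $1\le j\le k\le N_T$ $$b_{j,k}^{(\alpha_i)}=\sigma_{j,k}^{(\alpha_i)}-\sigma_{j-1,k}^{(\alpha_i)},\qquad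 \eta_{j,k}=\sum_{i=1}^n\frac{d_i}{\alpha_i\Delta t}b_{j,k}^{(\alpha_i)},\qquad \zeta_{j,k}=\frac{\eta_{j,k}}{\eta_{k,k}},\qquad \kappa=\eta_{k,k}^{-1}$$ ($\kappa$ does not depend on $k$, since $b_{k,k}^{(\alpha_i)}=1-\exp(-\alpha_i\Delta t/(1-\alpha_i))$). Truncation error: with the discrete operator $$F_t^{\alpha_i}u^1(x)=\frac{b_{1,1}^{(\alpha_i)}}{\alpha_i\Delta t}(u^1(x)-u^0(x)),\quad F_t^{\alpha_i}u^k(x)=\exp\left(-\frac{\alpha_i\Delta t}{1-\alpha_i}\right)F_t^{\alpha_i}u^{k-1}(x)+\frac{b_{k,k}^{(\alpha_i)}}{\alpha_i\Delta t}(u^k(x)-u^{k-1}(x))\ (k\ge2)$$ applied to the exact solution, set $$\widetilde R_k(x)=\kappa\sum_{i=1}^nd_i\left({}_0^{\mathrm{CF}}D_t^{\alpha_i}u(x,t_k)-F_t^{\alpha_i}u^k(x)\right).$$ Norms: $(u,v)=\int_\Lambda uv\,\mathrm{d}x$, $\|v\|_0=(v,v)^{1/2}$, $\|v\|_1=\left(\|v\|_0^2+\kappa\left\|\frac{\mathrm{d}v}{\mathrm{d}x}\right\|_0^2\right)^{1/2}$. Semi-discretized problem: given $u^0=\varphi$, for $k=1,\dots,N_T$ find $u^k\in H_0^1(\Lambda)$ such that for all $v\in H_0^1(\Lambda)$ $$(u^1,v)+\kappa\left(\frac{\partial u^1}{\partial x},\frac{\partial v}{\partial x}\right)=(u^0,v)+\kappa(f^1,v),$$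 $$(u^k,v)+\kappa\left(\frac{\partial u^k}{\partial x},\frac{\partial v}{\partial x}\right)=\sum_{j=1}^{k-1}(\zeta_{j+1,k}-\zeta_{j,k})(u^j,v)+\zeta_{1,k}(u^0,v)+\kappa(f^k,v),\quad k\ge2 .$$ *)

(* Defs.v *)
From HB Require Import structures.
From mathcomp Require Import all_boot all_order all_algebra.
From mathcomp Require Import all_classical all_reals all_analysis.

Set Implicit Arguments.
Unset Strict Implicit.
Unset Printing Implicit Defensive.

Import Order.TTheory GRing.Theory Num.Theory.
Import numFieldNormedType.Exports.

Local Open Scope classical_set_scope.
Local Open Scope ring_scope.

(* Functions of x : R stand for their restrictions to Lambda = ]0, S[; the
   values of a function outside Lambda are never used. *)
Definition dom (R : realType) (S : R) : set R := `]0, S[.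

Definition L2 (R : realType) (S : R) (v : R -> R) : Prop :=
  measurable_fun (dom S) v /\
  lebesgue_measure.-integrable (dom S) (fun x => (v x ^+ 2)%:E).

Definition ip (R : realType) (S : R) (v w : R -> R) : R :=
  \int[lebesgue_measure]_(x in dom S) (v x * w x).

Definition norm0 (R : realType) (S : R) (v : R -> R) : R :=
  Num.sqrt (ip S v v).

Definition test_function (R : realType) (S : R) (phi : R -> R) : Prop :=
  [/\ forall (m : nat) (x : R), derivable (derive1n m phi) x 1,
      compact (closure [set x | phi x != 0]) &
      closure [set x | phi x != 0] `<=` dom S].

Definition weak_derivative (R : realType) (S : R) (v w : R -> R) : Prop :=
  forall phi : R -> R, test_function S phi -> ip S v (derive1 phi) = - ip S w phi.

Definition H1 (R : realType) (S : R) (v : R -> R) : Prop :=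
  L2 S v /\ exists w : R -> R, L2 S w /\ weak_derivative S v w.

(* dv/dx for v in H1: some representative of the weak derivative, which is
   determined almost everywhere on Lambda; the zero function if v is not in
   H1. *)
Definition wD (R : realType) (S : R) (v : R -> R) : R -> R :=
  xget (fun=> 0) [set w | L2 S w /\ weak_derivative S v w].

Definition H2 (R : realType) (S : R) (v : R -> R) : Prop :=
  H1 S v /\ H1 S (wD S v).

(* The closure of the test functions in H1. *)
Definition H10 (R : realType) (S : R) (v : R -> R) : Prop :=
  H1 S v /\
  forall e : R, 0 < e -> exists phi : R -> R,
    [/\ test_function S phi,
        norm0 S (fun x => v x - phi x) < e &
        norm0 S (fun x => wD S v x - derive1 phi x) < e].

Definition norm1 (R : realType) (S kap : R) (v : R -> R) : R :=
  Num.sqrt (norm0 S v ^+ 2 + kap * norm0 S (wD S v) ^+ 2).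

(* g is C^2 in the open interval and g, g', g'' extend continuously to
   [0, T]. *)
Definition C2_segment (R : realType) (T : R) (g : R -> R) : Prop :=
  exists g1 g2 : R -> R,
    [/\ {within `[0, T], continuous g},
        {within `[0, T], continuous g1},
        {within `[0, T], continuous g2},
        (forall t, 0 < t < T -> is_derive t 1 g (g1 t)) &
        (forall t, 0 < t < T -> is_derive t 1 g1 (g2 t))].

(* The two-sided derivative derive1 g need not be meaningful at the end points
   s = 0 and s = T, which do not contribute to the integral. *)
Definition CF (R : realType) (a : R) (g : R -> R) (t : R) : R :=
  (1 - a)^-1 * \int[lebesgue_measure]_(s in `[0, t])
                 (derive1 g s * expR (- (a * ((t - s) / (1 - a))))).

Definition sigma (R : realType) (a dt : R) (j k : nat) : R :=
  expR (- (a * ((k%:R * dt - j%:R * dt) / (1 - a)))).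

Definition bcoef (R : realType) (a dt : R) (j k : nat) : R :=
  sigma a dt j k - sigma a dt j.-1 k.

(* Families indexed by i = 1, ..., n are functions on nat whose values at
   other indices are never used. *)
Definition eta (R : realType) (n : nat) (d a : nat -> R) (dt : R)
    (j k : nat) : R :=
  \sum_(1 <= i < n.+1) d i / (a i * dt) * bcoef (a i) dt j k.

Definition zeta (R : realType) (n : nat) (d a : nat -> R) (dt : R)
    (j k : nat) : R :=
  eta n d a dt j k / eta n d a dt k k.

(* The inverse of eta_{k,k} for any k >= 1, see etakk. *)
Definition kappa (R : realType) (n : nat) (d a : nat -> R) (dt : R) : R :=
  (eta n d a dt 1 1)^-1.

Lemma etakk (R : realType) (n : nat) (d a : nat -> R) (dt : R) (k : nat) :
  (0 < k)%N -> eta n d a dt k k = eta n d a dt 1 1.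
Proof.
case: k => // k _; rewrite /eta; apply: eq_bigr => i _.
suff E (m : nat) : bcoef (a i) dt m.+1 m.+1 =
    1 - expR (- (a i * (dt / (1 - a i)))) by rewrite !E.
rewrite /bcoef /sigma succnK subrr mul0r mulr0 oppr0 expR0.
by rewrite -mulrBl -natrB // subSnn mul1r.
Qed.

(* F_t^a g^k for a sequence g of values at the nodes t_0, t_1, ...; it is
   defined for k >= 1 only, and the value at k = 0 is a dummy. *)
Fixpoint Fop (R : realType) (a dt : R) (g : nat -> R) (k : nat) : R :=
  match k with
  | 0 => 0
  | 1 => bcoef a dt 1 1 / (a * dt) * (g 1%N - g 0%N)
  | (m.+1 as k').+1 =>
      expR (- (a * dt / (1 - a))) * Fop a dt g k'
      + bcoef a dt k k / (a * dt) * (g k - g k')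
  end.

Definition Rtilde (R : realType) (n : nat) (d a : nat -> R) (dt : R)
    (u : R -> R -> R) (k : nat) (x : R) : R :=
  kappa n d a dt *
  \sum_(1 <= i < n.+1)
    d i * (CF (a i) (u x) (k%:R * dt) -
           Fop (a i) dt (fun j => u x (j%:R * dt)) k).

(* In u x t the space variable comes first. *)
Definition smooth_solution (R : realType) (T S : R) (u : R -> R -> R) : Prop :=
  [/\ forall x, dom S x -> C2_segment T (u x),
      exists M : R, forall x t, dom S x -> 0 < t < T ->
        `|derive1n 2 (u x) t| <= M &
      forall t, 0 <= t <= T -> H2 S (u ^~ t) /\ H10 S (u ^~ t)].

(* The second space derivative of u(., t) in H2 is the weak one, so that the
   equation is an identity almost everywhere in x. *)
Definition exact_solution (R : realType) (T S : R) (n : nat) (d a : nat -> R)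
    (f : R -> R -> R) (phi : R -> R) (u : R -> R -> R) : Prop :=
  [/\ forall t, 0 < t <= T ->
        {ae lebesgue_measure, forall x, dom S x ->
          \sum_(1 <= i < n.+1) d i * CF (a i) (u x) t =
          wD S (wD S (u ^~ t)) x + f x t},
      forall x, dom S x -> u x 0 = phi x &
      forall t, 0 <= t <= T -> u 0 t = 0 /\ u S t = 0].

Definition semidiscrete_solution (R : realType) (T S : R) (n : nat)
    (d a : nat -> R) (f : R -> R -> R) (phi : R -> R) (N : nat)
    (U : nat -> R -> R) : Prop :=
  let dt := T / N%:R in
  let kap := kappa n d a dt in
  let z := zeta n d a dt in
  [/\ forall x, dom S x -> U 0%N x = phi x,
      forall k, (1 <= k <= N)%N -> H10 S (U k),
      (1 <= N)%N -> forall v, H10 S v ->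
        ip S (U 1%N) v + kap * ip S (wD S (U 1%N)) (wD S v) =
        ip S (U 0%N) v + kap * ip S (f ^~ (1%:R * dt)) v &
      forall k, (2 <= k <= N)%N -> forall v, H10 S v ->
        ip S (U k) v + kap * ip S (wD S (U k)) (wD S v) =
        \sum_(1 <= j < k) (z j.+1 k - z j k) * ip S (U j) v
        + z 1%N k * ip S (U 0%N) v
        + kap * ip S (f ^~ (k%:R * dt)) v].

(* Main.v *)
(* Write w(s) = exp(-a(t_k - s)/(1-a)).  The difference between the
   Caputo-Fabrizio derivative and its discretization is a sum over the time
   steps of the integrals of (u' - mean of u') (w - w(left end)) / (1-a); both
   factors are O(dt), so each step contributes O(dt^3) and the sum is O(dt^2),
   while kappa stays bounded as dt -> 0.  The error e^k solves the
   semi-discrete problem with zero initial value and source -R_k.  Testing with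
   e^k, Cauchy-Schwarz and sum_j (zeta_{j+1,k} - zeta_{j,k}) = 1 - zeta_{1,k}
   give |e^k|_1 <= max |R|_0 / zeta_{1,k} by induction on k, and
   1 / zeta_{1,k} <= exp(a_n T/(1 - a_n)).  Since dv/dx is an arbitrary
   representative of the weak derivative, its linearity requires uniqueness
   almost everywhere, for which indicators of intervals are obtained as limits
   of the test functions exp(-1/(m(x-a)) - 1/(m(b-x))) as m -> oo. *)
Require Import Defs.
From mathcomp Require Import all_boot all_order all_algebra.
From mathcomp Require Import all_classical all_reals all_analysis.
From mathcomp Require Import measurable_realfun ring lra.
Set Implicit Arguments.
Unset Strict Implicit.
Unset Printing Implicit Defensive.
Import Order.TTheory GRing.Theory Num.Theory.
Import numFieldNormedType.Exports.
Local Open Scope classical_set_scope.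
Local Open Scope ring_scope.

(** * Truncation error *)

Lemma Rintegral_FTC2 (R : realType) (f F : R -> R) (p q : R) : p < q ->
  {within `[p, q], continuous f} -> {within `[p, q], continuous F} ->
  (forall x, p < x < q -> is_derive x 1 F (f x)) ->
  \int[lebesgue_measure]_(x in `[p, q]) f x = F q - F p.
Proof.
move=> pq cf cF dF.
have [_ Fp Fq] := (continuous_within_itvP F pq).1 cF.
rewrite /Rintegral (continuous_FTC2 pq cf (F := F))//; first split => //.
- by move=> x /[!in_itv]/= /dF [].
- by move=> x /[!in_itv]/= /dF H; rewrite derive1E derive_val.
Qed.

Lemma exp_kernel_derive (R : realType) (l q x : R) :
  is_derive x 1 (fun s => expR (- (l * (q - s)))) (l * expR (- (l * (q - x)))).
Proof.
have -> : (fun s => expR (- (l * (q - s)))) = expR \o (fun s => - (l * (q - s))).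
  by [].
rewrite mulrC; apply: is_derive1_comp.
apply: is_derive_eq.
by rewrite add0r mul1r scalerN opprK /GRing.scale /= mulr1.
Qed.

Lemma continuous_exp_kernel (R : realType) (l q : R) (A : set R) :
  {within A, continuous (fun s => expR (- (l * (q - s))))}.
Proof.
apply: continuous_subspaceT => x.
apply/differentiable_continuous/derivable1_diffP.
by have [] := exp_kernel_derive l q x.
Qed.

(** Mean value theorem: the kernel has derivative [l * expR (- (l * (q - c)))], at most [l] because
    [c <= q]. *)
Lemma exp_kernel_bound (R : realType) (l p q s : R) :
  0 <= l -> p <= s <= q ->
  `|expR (- (l * (q - s))) - expR (- (l * (q - p)))| <= l * (q - p).
Proof.
move=> l0 /andP[ps sq].
have [c /[!in_itv]/= /andP[pc cs] ->] := MVT_segment ps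
  (fun x _ => exp_kernel_derive l q x) (@continuous_exp_kernel R l q _).
have e1 : expR (- (l * (q - c))) <= 1.
  by rewrite expR_le1 oppr_le0 mulr_ge0// subr_ge0 (le_trans cs).
rewrite ger0_norm ?mulr_ge0 ?expR_ge0 ?subr_ge0//.
rewrite -mulrA ler_wpM2l//; apply: (@le_trans _ _ (1 * (s - p))).
  by rewrite ler_wpM2r ?subr_ge0.
by rewrite mul1r lerD2r.
Qed.

(* The difference is the integral of (g' - avg g') (w - w p) with
   w s = exp (- l (q - s)), where both factors are O(h). *)
Lemma exp_kernel_quadrature (R : realType) (l M p q : R) (g g1 g2 : R -> R) :
  0 < l -> p < q ->
  {within `[p, q], continuous g} -> {within `[p, q], continuous g1} ->
  (forall t, p < t < q -> is_derive t 1 g (g1 t)) ->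
  (forall t, p < t < q -> is_derive t 1 g1 (g2 t)) ->
  (forall t, p < t < q -> `|g2 t| <= M) ->
  `|\int[lebesgue_measure]_(s in `[p, q]) (g1 s * expR (- (l * (q - s)))) -
    (g q - g p) / (q - p) * ((1 - expR (- (l * (q - p)))) / l)|
  <= l * M * (q - p) ^+ 3.
Proof.
move=> l0 pq cg cg1 dg dg1 g2M.
have h0 : 0 < q - p by rewrite subr_gt0.
set w := fun s => expR (- (l * (q - s))).
have cw : {within `[p, q], continuous w} := @continuous_exp_kernel R l q _.
set m := (g q - g p) / (q - p).
have M0 : 0 <= M.
  by apply: le_trans (normr_ge0 _) (g2M ((p + q) / 2) _); rewrite midf_lt// midf_lt.
(* The mean slope [m] is a value of [g1], so a second use of the mean value theorem, now on [g1],
   bounds [g1 s - m] by [M * (q - p)]. *)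
have [x0 /[!in_itv]/= x0pq gm] : exists2 x, x \in `]p, q[ & m = g1 x.
  have [x xpq E] := MVT pq (fun x xpq => dg x (etrans (esym (in_itv _ _)) xpq)) cg.
  by exists x => //; rewrite /m E mulfK// gt_eqF.
have g1m s : p <= s <= q -> `|g1 s - m| <= M * (q - p).
  have H y z : y <= z -> p <= y -> z <= q -> `|g1 z - g1 y| <= M * (q - p).
    move=> yz py zq; have [yz0|yz0] := eqVneq y z.
      by rewrite yz0 subrr normr0 mulr_ge0// ltW.
    have {yz yz0} yz : y < z by rewrite lt_neqAle yz0.
    have dg1' x : x \in `]y, z[ -> is_derive x 1 g1 (g2 x).
      rewrite in_itv/= => /andP[yx xz]; apply: dg1.
      by rewrite (le_lt_trans py)// (lt_le_trans xz).
    have [|c /[!in_itv]/= /andP[yc cz] ->] := MVT yz dg1'.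
      apply: continuous_subspaceW cg1 => x /=; rewrite !in_itv/= => /andP[yx xz].
      by rewrite (le_trans py)// (le_trans xz).
    rewrite normrM (gtr0_norm (_ : 0 < z - y)) ?subr_gt0//.
    apply: ler_pM => //; first by rewrite subr_ge0 ltW.
      by apply: g2M; rewrite (le_lt_trans py)//= (lt_le_trans cz).
    by rewrite lerB.
  case/andP: x0pq => px xq /andP[ps sq]; rewrite gm.
  have [sx|/ltW sx] := leP x0 s; first by apply: H => //; exact: ltW.
  by rewrite distrC; apply: H => //; exact: ltW.
(* Chosen so that [g1 * w - r = (g1 - m) * (w - w p)]. The part [w p * (g1 - m)] of [r] has integral
   zero, hence [r] integrates to [m] times the integral of [w], which is the discrete term. [P] is
   an antiderivative of [r]. *)
set r := fun s => m * w s + w p * g1 s - m * w p.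
pose P s := m / l * w s + w p * g s - m * w p * s.
have cr : {within `[p, q], continuous r}.
  move=> x; apply: cvgB; last exact: cvg_cst.
  by apply: cvgD; apply: cvgM; (try exact: cvg_cst); [exact: cw|exact: cg1].
have intr : \int[lebesgue_measure]_(x in `[p, q]) r x = m * ((1 - w p) / l).
  have dP x : p < x < q -> is_derive x 1 P (r x).
    move=> xpq; have dx := dg _ xpq; have ex := exp_kernel_derive l q x.
    rewrite /P; apply: is_derive_eq; rewrite /r /GRing.scale /= -/(w x).
    by field; rewrite gt_eqF.
  have cP : {within `[p, q], continuous P}.
    move=> x; apply: cvgB.
      by apply: cvgD; apply: cvgM; (try exact: cvg_cst); [exact: cw|exact: cg].
    by apply: cvgM; [exact: cvg_cst|apply: continuous_subspaceT => ?; exact: cvg_id].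
  rewrite (Rintegral_FTC2 pq cr cP dP) /P /w subrr mulr0 oppr0 expR0.
  have E : g q = g p + m * (q - p) by rewrite /m divfK ?gt_eqF//; ring.
  rewrite E.
  by field; rewrite gt_eqF.
have itg f : {within `[p, q], continuous f} ->
    lebesgue_measure.-integrable `[p, q] (EFin \o f).
  by move=> cf; apply: continuous_compact_integrable => //; exact: segment_compact.
have cgw : {within `[p, q], continuous (fun s => g1 s * w s)}.
  by move=> x; apply: cvgM; [exact: cg1|exact: cw].
rewrite -intr -RintegralB//; try exact: itg.
have cgwr : {within `[p, q], continuous (fun s => g1 s * w s - r s)}.
  by move=> x; apply: cvgB; [exact: cgw|exact: cr].
apply: le_trans (le_normr_Rintegral _ (itg _ cgwr)) _ => //.
(* Two factors [q - p] come from the pointwise bound and the third from the length of the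
   interval. *)
have -> : l * M * (q - p) ^+ 3 =
    \int[lebesgue_measure]_(x in `[p, q]) (l * M * (q - p) ^+ 2).
  rewrite Rintegral_cst//= lebesgue_measure_itv/= lte_fin pq /= exprSr.
  by rewrite mulrA.
apply: le_Rintegral => //.
- by apply: itg => x; apply: cvg_norm; exact: cgwr.
- by apply: itg => x; exact: cvg_cst.
- move=> x /=; rewrite in_itv/= => xpq.
  have -> : g1 x * w x - r x = (g1 x - m) * (w x - w p) by rewrite /r; ring.
  rewrite normrM.
  have := exp_kernel_bound (ltW l0) xpq; rewrite -/(w x) -/(w p).
  move=> /(ler_pM (normr_ge0 _) (normr_ge0 _) (g1m _ xpq))/le_trans; apply.
  by rewrite le_eqVlt; apply/orP; left; apply/eqP; ring.
Qed.

(** * Truncation error accumulated over the time steps *)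

Lemma C2_segment_derive1 (R : realType) (T t : R) (g g1 : R -> R) :
  (forall t, 0 < t < T -> is_derive t 1 g (g1 t)) -> 0 < t < T ->
  derive1 g t = g1 t.
Proof. by move=> dg /dg H; rewrite derive1E derive_val. Qed.

Lemma C2_segment_derive2 (R : realType) (T t : R) (g g1 g2 : R -> R) :
  (forall t, 0 < t < T -> is_derive t 1 g (g1 t)) ->
  (forall t, 0 < t < T -> is_derive t 1 g1 (g2 t)) -> 0 < t < T ->
  derive1n 2 g t = g2 t.
Proof.
move=> dg dg1 tT; have H := dg1 _ tT.
rewrite /derive1n/= derive1E -[RHS](@derive_val _ _ _ _ _ _ _ H).
apply: near_eq_derive; near=> s; apply: (C2_segment_derive1 dg).
have : s \in `]0, T[ by near: s; apply: near_in_itvoo; rewrite in_itv.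
by rewrite in_itv.
Unshelve. all: by end_near. Qed.

(** The end points form a null set, so [derive1 g], uncontrolled there, can be exchanged for the
    continuous extension [g1]; the integrand then becomes continuous on the closed interval. *)
Lemma CFE (R : realType) (a T t : R) (g g1 : R -> R) : t <= T ->
  {within `[0, T], continuous g1} ->
  (forall t, 0 < t < T -> is_derive t 1 g (g1 t)) ->
  CF a g t = (1 - a)^-1 * \int[lebesgue_measure]_(s in `[0, t])
    (g1 s * expR (- (a / (1 - a) * (t - s)))).
Proof.
move=> tT cg1 dg; congr (_ * fine _).
have E : {in `]0, t[, (fun s => g1 s * expR (- (a / (1 - a) * (t - s)))) =1
    (fun s => derive1 g s * expR (- (a * ((t - s) / (1 - a)))))}.
  move=> s; rewrite in_itv/= => /andP[s0 st].
  rewrite (C2_segment_derive1 dg) ?s0 ?(lt_le_trans st)//.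
  by rewrite -mulrA (mulrC _^-1).
have mg1 : measurable_fun `]0, t[ (fun s => g1 s * expR (- (a / (1 - a) * (t - s)))).
  apply: (@measurable_funS _ _ _ _ `[0, T]) => //.
    move=> x /=; rewrite !in_itv/= => /andP[x0 xt].
    by rewrite (ltW x0) (le_trans (ltW xt)).
  apply: subspace_continuous_measurable_fun => // x.
  by apply: cvgM; [exact: cg1|exact: continuous_exp_kernel].
apply: esym; apply: eq_integral_itv_bounded => //.
by apply: eq_measurable_fun mg1 => x /[1!inE]; exact: E.
Qed.

Lemma bcoef_diag (R : realType) (a dt : R) (k : nat) :
  bcoef a dt k.+1 k.+1 = 1 - expR (- (a / (1 - a) * dt)).
Proof.
rewrite /bcoef /sigma subrr mul0r mulr0 oppr0 expR0 -mulrBl -natrB// subSnn mul1r.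
by rewrite mulrA mulrAC.
Qed.

(** One recursion for all steps: thanks to the dummy value 0 at [k = 0], the first step is an
    instance of the general one. *)
Lemma FopS (R : realType) (a dt : R) (g : nat -> R) (k : nat) :
  Fop a dt g k.+1 = expR (- (a / (1 - a) * dt)) * Fop a dt g k +
    (1 - expR (- (a / (1 - a) * dt))) / (a * dt) * (g k.+1 - g k).
Proof.
case: k => [|k]; first by rewrite /= mulr0 add0r bcoef_diag.
transitivity (expR (- (a * dt / (1 - a))) * Fop a dt g k.+1 +
  bcoef a dt k.+2 k.+2 / (a * dt) * (g k.+2 - g k.+1)) => //.
by rewrite bcoef_diag (mulrAC a).
Qed.

(** [CF] obeys the recursion of [FopS], with an exact integral over the last step: the past is
    multiplied by a factor at most 1. Earlier errors are therefore not amplified, and each step adds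
    one error of [exp_kernel_quadrature]. *)
Lemma CF_Fop_error (R : realType) (a T M dt : R) (g : R -> R) (k : nat) :
  0 < a < 1 -> 0 < dt -> C2_segment T g ->
  (forall t, 0 < t < T -> `|derive1n 2 g t| <= M) -> k%:R * dt <= T ->
  `|CF a g (k%:R * dt) - Fop a dt (fun j => g (j%:R * dt)) k| <=
  k%:R * ((1 - a)^-1 * (a / (1 - a) * M * dt ^+ 3)).
Proof.
move=> /andP[a0 a1] dt0 [g1 [g2 [cg cg1 _ dg dg1]]] g2M.
have b0 : 0 < 1 - a by rewrite subr_gt0.
pose l := a / (1 - a); have l0 : 0 < l by rewrite divr_gt0.
elim: k => [|k IH] kT.
  rewrite (CFE _ kT cg1 dg) !mul0r set_itv1 Rintegral_set1 mulr0.
  by rewrite /Fop subr0 normr0.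
set p := k%:R * dt; set q := k.+1%:R * dt.
have qp : q - p = dt by rewrite /q /p -mulrBl -natrB// subSnn mul1r.
have pq : p < q by rewrite -subr_gt0 qp.
have p0 : 0 <= p by rewrite mulr_ge0// ltW.
have pT : p <= T by rewrite (le_trans (ltW pq)).
have cS (r s : R) (f : R -> R) : 0 <= r -> s <= T ->
    {within `[0, T], continuous f} -> {within `[r, s], continuous f}.
  move=> r0 sT; apply: continuous_subspaceW => x /=; rewrite !in_itv/= => /andP[rx xs].
  by rewrite (le_trans r0)// (le_trans xs).
have ltT t : p < t < q -> 0 < t < T.
  by case/andP=> pt tq; rewrite (le_lt_trans p0)// (lt_le_trans tq).
have := @exp_kernel_quadrature R l M p q g g1 g2 l0 pq (cS _ _ _ p0 kT cg)
  (cS _ _ _ p0 kT cg1) (fun t H => dg _ (ltT _ H)) (fun t H => dg1 _ (ltT _ H)).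
have g2M' t : p < t < q -> `|g2 t| <= M.
  by move=> /ltT tT; rewrite -(C2_segment_derive2 dg dg1 tT) g2M.
rewrite qp => /(_ g2M'); set J := Rintegral _ _ _ => HJ.
have cw r : {within `[0, T], continuous
    (fun s => g1 s * expR (- (l * (r - s))))}.
  by move=> x; apply: cvgM; [exact: cg1|exact: continuous_exp_kernel].
have itw (r s t : R) : 0 <= r -> s <= T -> lebesgue_measure.-integrable `[r, s]
    (EFin \o (fun s => g1 s * expR (- (l * (t - s))))).
  move=> r0 sT; apply: continuous_compact_integrable; first exact: segment_compact.
  exact: cS (cw _).
(* The integral is split at [p]; on [[0, p]] the kernel centred at [q] is [expR (- (l * dt))] times
   the kernel centred at [p]. *)
have CFS : CF a g q = expR (- (l * dt)) * CF a g p + (1 - a)^-1 * J.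
  rewrite (CFE _ kT cg1 dg) (CFE _ pT cg1 dg) mulrCA -mulrDr -/l; congr (_ * _).
  rewrite -RintegralZl//; last exact: itw.
  have <- : \int[lebesgue_measure]_(x in `[0, p])
      (g1 x * expR (- (l * (q - x)))) = \int[lebesgue_measure]_(x in `[0, p])
      (expR (- (l * dt)) * (g1 x * expR (- (l * (p - x))))).
    apply: eq_Rintegral => x _; rewrite mulrCA -expRD -qp; congr (_ * expR _); ring.
  apply/eqP; rewrite addrC -subr_eq; apply/eqP.
  rewrite Rintegral_itvB ?bnd_simp//; [|exact: itw|exact: ltW].
  rewrite Rintegral_itv_obnd_cbnd//.
  apply: integrableS (itw p q q p0 kT) => //.
  by apply: subset_itvr; rewrite bnd_simp.
rewrite CFS FopS -/l.
set e := expR _ in HJ *; set m := g q - g p in HJ *.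
have e01 : 0 <= e <= 1.
  by rewrite expR_ge0 expR_le1 oppr_le0 mulr_ge0// ltW.
(* The normalizations agree because [l * (1 - a) = a]. *)
have -> : e * CF a g p + (1 - a)^-1 * J -
   (e * Fop a dt (fun j : nat => g (j%:R * dt)) k + (1 - e) / (a * dt) * m) =
   e * (CF a g p - Fop a dt (fun j : nat => g (j%:R * dt)) k) +
   (1 - a)^-1 * (J - m / dt * ((1 - e) / l)).
  by rewrite /l; field; rewrite !gt_eqF.
rewrite -[in leRHS]natr1 [leRHS]mulrDl mul1r.
apply: le_trans (ler_normD _ _) _; apply: lerD; last first.
  by rewrite normrM gtr0_norm ?invr_gt0// ler_wpM2l// ltW// invr_gt0.
apply: le_trans (IH pT); rewrite normrM ler_piMl//.
by case/andP: e01 => e0 e1; rewrite ger0_norm.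
Qed.

(** * Discrete coefficients and stability *)

(* A is an upper bound of the orders, namely a_n in the theorem. *)
Definition admissible_data (R : realType) (n : nat) (d a : nat -> R) (A : R) :=
  [/\ forall i, (1 <= i < n.+1)%N -> 0 <= d i,
      exists2 i, (1 <= i < n.+1)%N & 0 < d i,
      forall i, (1 <= i < n.+1)%N -> 0 < a i <= A &
      A < 1].

(** * Sign, shift and monotonicity properties of the coefficients *)

Lemma bcoefS (R : realType) (a dt : R) (j k : nat) :
  bcoef a dt j k.+1 = expR (- (a / (1 - a) * dt)) * bcoef a dt j k.
Proof.
rewrite /bcoef mulrBr /sigma -!expRD -natr1.
by congr (expR _ - expR _); ring.
Qed.

(** Only the difference of the two indices matters. The shift starts at [j.+2] since
    [bcoef a dt 0 k] is 0, the predecessor of 0 being 0. *)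
Lemma bcoefSS (R : realType) (a dt : R) (j k : nat) :
  bcoef a dt j.+2 k.+1 = bcoef a dt j.+1 k.
Proof.
rewrite /bcoef /sigma /= -!natr1.
by congr (expR _ - expR _); ring.
Qed.

Lemma bcoef_gt0 (R : realType) (a dt : R) (j k : nat) :
  0 < a < 1 -> 0 < dt -> 0 < bcoef a dt j.+1 k.
Proof.
move=> /andP[a0 a1] dt0; rewrite subr_gt0 /sigma ltr_expR ltrN2.
rewrite ltr_pM2l// ltr_pM2r ?invr_gt0 ?subr_gt0// ltrD2l ltrN2.
by rewrite ltr_pM2r// ltr_nat.
Qed.

(** Unrolled recursion: the factor applied to the past at each step is exactly what advances the
    second index of [bcoef]. *)
Lemma Fop_sum (R : realType) (a dt : R) (g : nat -> R) (k : nat) :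
  Fop a dt g k =
  \sum_(1 <= j < k.+1) bcoef a dt j k / (a * dt) * (g j - g j.-1).
Proof.
elim: k => [|k IH]; first by rewrite big_geq.
rewrite FopS IH [RHS]big_nat_recr//= -(bcoef_diag a dt k); congr (_ + _).
by rewrite big_distrr/=; apply: eq_bigr => j _; rewrite bcoefS !mulrA.
Qed.

Lemma sum_Fop (R : realType) (n : nat) (d a : nat -> R) (dt : R)
    (g : nat -> R) (k : nat) :
  \sum_(1 <= i < n.+1) d i * Fop (a i) dt g k =
  \sum_(1 <= j < k.+1) eta n d a dt j k * (g j - g j.-1).
Proof.
under eq_bigr do rewrite Fop_sum big_distrr/=.
rewrite exchange_big/=; apply: eq_bigr => j _.
rewrite /eta big_distrl/=; apply: eq_bigr => i _.
by rewrite -!mulrA; congr (_ * _); rewrite mulrCA.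
Qed.

Lemma eta_gt0 (R : realType) (n : nat) (d a : nat -> R) (A dt : R) (j k : nat) :
  admissible_data n d a A -> 0 < dt -> 0 < eta n d a dt j.+1 k.
Proof.
move=> [d0 [i ni di] aA A1] dt0.
have b0 m : (1 <= m < n.+1)%N -> 0 < (a m * dt)^-1 * bcoef (a m) dt j.+1 k.
  move=> /aA/andP[am mA]; rewrite mulr_gt0 ?invr_gt0 ?mulr_gt0//.
  by rewrite bcoef_gt0// am (le_lt_trans mA).
rewrite /eta (bigD1_seq i)/= ?mem_index_iota ?iota_uniq//.
apply: ltr_pwDl; first by rewrite -mulrA mulr_gt0// b0.
rewrite big_seq_cond; apply: sumr_ge0 => m /andP[+ _].
by rewrite mem_index_iota => nm; rewrite -mulrA mulr_ge0 ?d0// ltW// b0.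
Qed.

Lemma kappa_gt0 (R : realType) (n : nat) (d a : nat -> R) (A dt : R) :
  admissible_data n d a A -> 0 < dt -> 0 < kappa n d a dt.
Proof. by move=> H dt0; rewrite invr_gt0; exact: eta_gt0 H dt0. Qed.

Lemma etaSS (R : realType) (n : nat) (d a : nat -> R) (dt : R) (j k : nat) :
  eta n d a dt j.+2 k.+1 = eta n d a dt j.+1 k.
Proof. by apply: eq_bigr => i _; rewrite bcoefSS. Qed.

Lemma etaS_le (R : realType) (n : nat) (d a : nat -> R) (A dt : R) (j k : nat) :
  admissible_data n d a A -> 0 < dt ->
  eta n d a dt j.+1 k.+1 <= eta n d a dt j.+1 k.
Proof.
move=> [d0 _ aA A1] dt0; rewrite /eta big_seq [leRHS]big_seq.
apply: ler_sum => i; rewrite mem_index_iota => ni.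
have /andP[ai iA] := aA _ ni; have a1 := le_lt_trans iA A1.
rewrite ler_wpM2l//; first by rewrite divr_ge0 ?d0// ltW// mulr_gt0.
rewrite bcoefS ler_piMl//; first by rewrite ltW// bcoef_gt0// ai.
by rewrite expR_le1 oppr_le0 mulr_ge0 ?divr_ge0 ?subr_ge0// ltW.
Qed.

Lemma zetakk (R : realType) (n : nat) (d a : nat -> R) (A dt : R) (k : nat) :
  admissible_data n d a A -> 0 < dt -> zeta n d a dt k.+1 k.+1 = 1.
Proof. by move=> H dt0; rewrite /zeta divff// gt_eqF// (eta_gt0 _ _ H). Qed.

(** By shift invariance, raising [j] amounts to lowering [k], and [eta] decreases in [k]. This makes
    the weights of the semi-discrete scheme nonnegative. *)
Lemma zeta_le_succ (R : realType) (n : nat) (d a : nat -> R) (A dt : R)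
    (j k : nat) : admissible_data n d a A -> 0 < dt -> (0 < j)%N -> (0 < k)%N ->
  zeta n d a dt j k <= zeta n d a dt j.+1 k.
Proof.
case: j k => // j [//|k] H dt0 _ _; rewrite /zeta ler_wpM2r//.
  by rewrite invr_ge0 ltW// (eta_gt0 _ _ H).
by rewrite etaSS (etaS_le _ _ H).
Qed.

Lemma zeta1_gt0 (R : realType) (n : nat) (d a : nat -> R) (A dt : R) (k : nat) :
  admissible_data n d a A -> 0 < dt -> (0 < k)%N -> 0 < zeta n d a dt 1 k.
Proof. by case: k => // k H dt0 _; rewrite divr_gt0// (eta_gt0 _ _ H). Qed.

Lemma zeta1_le (R : realType) (n : nat) (d a : nat -> R) (A dt : R) (j k : nat) :
  admissible_data n d a A -> 0 < dt -> (0 < j <= k)%N ->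
  zeta n d a dt 1 k <= zeta n d a dt 1 j.
Proof.
move=> H dt0 /andP[j0 jk].
rewrite /zeta (etakk _ _ _ _ j0) (etakk _ _ _ _ (leq_trans j0 jk)).
rewrite ler_wpM2r ?invr_ge0 ?(ltW (eta_gt0 _ _ H _))//.
have {jk} := jk; move: k; elim=> [|k IH]; first by rewrite leqn0 => /eqP ->.
rewrite leq_eqVlt => /predU1P[->//|/IH]; apply: le_trans.
exact: etaS_le H dt0.
Qed.

(** Source of the exponential in the error estimate. Term by term, going from index 1 to [k] costs
    the factor [exp(-(k-1) dt a_i/(1-a_i))]; here [(k-1) dt <= T], and [a/(1-a)] increases with
    [a]. *)
Lemma zeta1_ge (R : realType) (n : nat) (d a : nat -> R) (A T dt : R) (k : nat) :
  admissible_data n d a A -> 0 < dt -> (0 < k)%N -> k%:R * dt <= T ->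
  expR (- (A * T / (1 - A))) <= zeta n d a dt 1 k.
Proof.
case: k => // k H dt0 _ kT; rewrite /zeta etakk// ler_pdivlMr ?(eta_gt0 _ _ H)//.
have [d0 _ aA A1] := H.
rewrite /eta big_distrr/= big_seq [leRHS]big_seq; apply: ler_sum => i.
rewrite mem_index_iota => ni.
have /andP[ai iA] := aA _ ni; have a1 := le_lt_trans iA A1.
rewrite mulrCA ler_wpM2l//; first by rewrite divr_ge0 ?d0// ltW// mulr_gt0.
have -> : bcoef (a i) dt 1 k.+1 = expR (- (a i / (1 - a i) * (k%:R * dt))) *
    bcoef (a i) dt 1 1.
  elim: k {kT} => [|k IH]; first by rewrite mul0r mulr0 oppr0 expR0 mul1r.
  by rewrite bcoefS IH mulrA -expRD -natr1; congr (expR _ * _); ring.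
rewrite ler_wpM2r//; first by rewrite ltW// bcoef_gt0// ai.
rewrite ler_expR lerN2 [leRHS]mulrAC ler_pM//.
- by rewrite divr_ge0 ?subr_ge0// ltW.
- by rewrite mulr_ge0// ltW.
- apply: ler_pM => //; first exact: ltW; first by rewrite invr_ge0 subr_ge0 ltW.
  by rewrite lef_pV2 ?posrE ?subr_gt0// lerD2l lerN2.
- by apply: le_trans kT; rewrite ler_wpM2r ?ler_nat// ltW.
Qed.

(** From [exp(-x) <= 1/(1+x)] with [x = a_i dt/(1-a_i)], the coefficient of [d_i] in [eta] is at
    least [1/(1-a_i+a_i dt)], hence at least [1/(1+T)], uniformly in [dt]. *)
Lemma kappa_le (R : realType) (n : nat) (d a : nat -> R) (A T dt : R) :
  admissible_data n d a A -> 0 < dt <= T ->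
  kappa n d a dt * \sum_(1 <= i < n.+1) d i <= 1 + T.
Proof.
move=> H /andP[dt0 dtT]; have T0 : 0 < T by exact: lt_le_trans dtT.
rewrite /kappa ler_pdivrMl ?(eta_gt0 _ _ H)//.
have [d0 _ aA A1] := H.
rewrite mulrC /eta big_distrr/= big_seq [leRHS]big_seq; apply: ler_sum => i.
rewrite mem_index_iota => ni.
have /andP[ai iA] := aA _ ni; have a1 := le_lt_trans iA A1.
rewrite -mulrA mulrCA ler_peMr ?d0// bcoef_diag.
set l := a i / (1 - a i); have l0 : 0 < l by rewrite divr_gt0// subr_gt0.
have x0 : 0 < l * dt by rewrite mulr_gt0.
have e1 : expR (- (l * dt)) <= (1 + l * dt)^-1.
  rewrite expRN lef_pV2 ?posrE ?expR_gt0 ?addr_gt0//; exact: expR_ge1Dx.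
have : (l * dt) / (1 + l * dt) <= 1 - expR (- (l * dt)).
  apply: le_trans (lerB (lexx 1) e1).
  by rewrite le_eqVlt; apply/orP; left; apply/eqP; field; rewrite gt_eqF// addr_gt0.
move=> e2; rewrite mulrCA ler_pdivlMl ?mulr_gt0// mulr1.
rewrite [leRHS]mulrC -ler_pdivrMr ?addr_gt0//; apply: le_trans e2.
have b0 : 0 < 1 - a i by rewrite subr_gt0.
have -> : l * dt / (1 + l * dt) = a i * dt / (1 - a i + a i * dt).
  by rewrite /l; field; rewrite !gt_eqF//= addr_gt0// mulr_gt0.
rewrite ler_wpM2l//; first by rewrite mulr_ge0// ltW.
have c0 : 0 < 1 - a i + a i * dt by apply: addr_gt0 => //; exact: mulr_gt0.
rewrite lef_pV2 ?posrE//; last exact: addr_gt0.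
apply: lerD; first by rewrite gerBl ltW.
by apply: le_trans dtT; rewrite ler_piMl// ltW.
Qed.

(** In the constant, [1 + T] bounds [kappa] times the sum of the [d_i], [T] bounds the [k dt] left
    over from [k dt^3], and [(1-A)^-2] bounds [a_i/(1-a_i)^2]. *)
Lemma Rtilde_bound (R : realType) (n : nat) (d a : nat -> R) (A T M dt : R)
    (u : R -> R -> R) (x : R) (k : nat) :
  admissible_data n d a A -> 0 < dt -> (0 < k)%N -> k%:R * dt <= T ->
  C2_segment T (u x) -> 0 <= M ->
  (forall t, 0 < t < T -> `|derive1n 2 (u x) t| <= M) ->
  `|Rtilde n d a dt u k x| <= (1 + T) * (T * M * (1 - A)^-1 ^+ 2) * dt ^+ 2.
Proof.
move=> H dt0 k0 kT uC2 M0 uM; rewrite /Rtilde normrM.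
have kap0 := kappa_gt0 H dt0; rewrite gtr0_norm//.
have dtT : 0 < dt <= T.
  by rewrite dt0 (le_trans _ kT)// ler_peMl ?ler1n// ltW.
have [d0 _ aA A1] := H.
set C := T * M * _.
apply: (@le_trans _ _ (kappa n d a dt *
    ((\sum_(1 <= i < n.+1) d i) * (C * dt ^+ 2)))); last first.
  rewrite mulrA -[leRHS]mulrA ler_wpM2r ?(kappa_le H)//.
  rewrite /C !mulr_ge0 ?exprn_ge0 ?invr_ge0 ?subr_ge0// ?ltW//.
  by rewrite (lt_le_trans _ (andP dtT).2).
rewrite ler_wpM2l ?(ltW kap0)//; apply: le_trans (ler_norm_sum _ _ _) _.
rewrite big_distrl/= big_seq [leRHS]big_seq; apply: ler_sum => i.
rewrite mem_index_iota => ni.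
have /andP[ai iA] := aA _ ni; have a1 := le_lt_trans iA A1.
rewrite normrM ger0_norm ?d0// ler_wpM2l ?d0//.
have ai01 : 0 < a i < 1 by rewrite ai.
apply: le_trans (CF_Fop_error ai01 dt0 uC2 uM kT) _.
have iAV : (1 - a i)^-1 <= (1 - A)^-1.
  by rewrite lef_pV2 ?posrE ?subr_gt0// lerD2l lerN2.
have b0 : 0 <= (1 - a i)^-1 by rewrite invr_ge0 subr_ge0 ltW.
have -> : k%:R * ((1 - a i)^-1 * (a i / (1 - a i) * M * dt ^+ 3)) =
    ((k%:R * dt) * M) * (((1 - a i)^-1 * (1 - a i)^-1) * a i) * dt ^+ 2 by ring.
rewrite ler_wpM2r ?sqr_ge0//; apply: ler_pM.
- by rewrite !mulr_ge0// ltW.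
- by rewrite !mulr_ge0// ltW.
- by rewrite ler_wpM2r.
rewrite expr2 -[leRHS]mulr1; apply: ler_pM; [exact: mulr_ge0|exact: ltW| |exact: ltW].
by apply: ler_pM.
Qed.

(** Summation by parts, after [kappa * eta] has been recognized as [zeta]; it puts the discrete
    operator in the form used by the semi-discrete scheme. *)
Lemma kappa_sum_Fop (R : realType) (n : nat) (d a : nat -> R) (A dt : R)
    (g : nat -> R) (k : nat) :
  admissible_data n d a A -> 0 < dt -> (0 < k)%N ->
  kappa n d a dt * \sum_(1 <= i < n.+1) d i * Fop (a i) dt g k =
  g k - (\sum_(1 <= j < k) (zeta n d a dt j.+1 k - zeta n d a dt j k) * g j +
         zeta n d a dt 1 k * g 0%N).
Proof.
move=> H dt0 k0; rewrite sum_Fop big_distrr/=.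
rewrite (eq_bigr (fun j => zeta n d a dt j k * (g j - g j.-1))); last first.
  move=> j _; rewrite /zeta (etakk _ _ _ _ k0) -/(kappa _ _ _ _) mulrA.
  by rewrite (mulrC (kappa _ _ _ _)).
have zk : zeta n d a dt k k = 1 by case: k k0 => // k _; exact: zetakk H dt0.
(* The upper limit is decoupled from the second index [k], which stays fixed during the
   induction. *)
suff E m : (0 < m)%N -> \sum_(1 <= j < m.+1) zeta n d a dt j k * (g j - g j.-1) =
    zeta n d a dt m k * g m -
    (\sum_(1 <= j < m) (zeta n d a dt j.+1 k - zeta n d a dt j k) * g j +
     zeta n d a dt 1 k * g 0%N) by rewrite E// zk mul1r.
elim: m => // -[_ _|m IH _].
  by rewrite big_nat1 big_geq// add0r mulrBr.
rewrite big_nat_recr//= IH// [in RHS]big_nat_recr//=; ring.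
Qed.

(** A discrete Gronwall argument. Monotonicity of [z 1] raises all earlier bounds to [rho / z 1 k];
    the nonnegative weights telescope to [1 - z 1 k], and [(1 - z 1 k) * (rho / z 1 k) + rho = rho /
    z 1 k]. *)
Lemma discrete_stability (R : realType) (z : nat -> nat -> R) (E : nat -> R)
    (rho : R) (N : nat) : 0 <= rho ->
  (forall k, (0 < k <= N)%N -> 0 < z 1%N k) ->
  (forall k, (0 < k <= N)%N -> z k k = 1) ->
  (forall j k, (0 < j <= k)%N -> (k <= N)%N -> z 1%N k <= z 1%N j) ->
  (forall j k, (0 < j < k)%N -> (k <= N)%N -> z j k <= z j.+1 k) ->
  (forall k, (0 < k <= N)%N ->
    E k <= \sum_(1 <= j < k) (z j.+1 k - z j k) * E j + rho) ->
  forall k, (0 < k <= N)%N -> E k <= rho / z 1%N k.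
Proof.
move=> rho0 z0 zkk z1 zj HE; elim/ltn_ind => k IH kN.
have /andP[k0 kN'] := kN.
apply: le_trans (HE _ kN) _.
apply: (@le_trans _ _ (\sum_(1 <= j < k) (z j.+1 k - z j k) * (rho / z 1%N k) + rho)).
  rewrite lerD2r big_seq [leRHS]big_seq; apply: ler_sum => j.
  rewrite mem_index_iota => /andP[j0 jk].
  have jN : (0 < j <= N)%N by rewrite j0 (leq_trans (ltnW jk)).
  rewrite ler_wpM2l//; first by rewrite subr_ge0 zj// j0.
  apply: le_trans (IH _ jk jN) _; rewrite ler_wpM2l// lef_pV2 ?posrE ?z0//.
  by rewrite z1// j0 ltnW.
rewrite -big_distrl/= telescope_sumr// zkk//.
by rewrite le_eqVlt; apply/orP; left; apply/eqP; field; rewrite gt_eqF// z0.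
Qed.

(** * Square-integrable functions *)

Lemma measurable_dom (R : realType) (S : R) :
  measurable (dom S : set (measurableTypeR R)).
Proof. exact: measurable_itv. Qed.
#[local] Hint Resolve measurable_dom : core.

Lemma aeS (R : realType) (P Q : R -> Prop) : (forall x, P x -> Q x) ->
  {ae lebesgue_measure, forall x, P x} -> {ae lebesgue_measure, forall x, Q x}.
Proof.
by move=> PQ; apply: filterS; [exact: (ae_filter_ringOfSetsType lebesgue_measure)|].
Qed.

Lemma L2D (R : realType) (S : R) (v w : R -> R) :
  L2 S v -> L2 S w -> L2 S (fun x => v x + w x).
Proof.
move=> [mv iv] [mw iw]; split; first exact: measurable_funD.
have i2 := integrableZl (measurable_dom S) 2 (integrableD (measurable_dom S) iv iw).
apply: (le_integrable (measurable_dom S) _ _ i2).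
  by apply/measurable_EFinP; apply: measurable_funX; exact: measurable_funD.
move=> x _; rewrite -!EFinD -!EFinM /= lee_fin.
rewrite !ger0_norm ?sqr_ge0//; last by rewrite mulr_ge0// addr_ge0// sqr_ge0.
have := sqr_ge0 (v x - w x); nra.
Qed.

Lemma L2Z (R : realType) (S c : R) (v : R -> R) :
  L2 S v -> L2 S (fun x => c * v x).
Proof.
move=> [mv iv]; split; first by apply: measurable_funM => //; exact: measurable_cst.
have i2 := integrableZl (measurable_dom S) (c ^+ 2) iv.
apply: (le_integrable (measurable_dom S) _ _ i2).
  apply/measurable_EFinP; apply: measurable_funX.
  by apply: measurable_funM => //; exact: measurable_cst.
by move=> x _; rewrite -EFinM exprMn.
Qed.

Lemma L2B (R : realType) (S : R) (v w : R -> R) :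
  L2 S v -> L2 S w -> L2 S (fun x => v x - w x).
Proof.
move=> Lv Lw; have := L2D Lv (L2Z (-1) Lw).
by congr (L2 S _); apply/funext => x; rewrite mulN1r.
Qed.

Lemma L2_0 (R : realType) (S : R) : L2 S (fun=> 0).
Proof.
split; first exact: measurable_cst.
by rewrite expr0n; exact: integrable0.
Qed.

Lemma L2_sum (R : realType) (S : R) (I : eqType) (s : seq I) (c : I -> R)
    (v : I -> R -> R) : (forall i, i \in s -> L2 S (v i)) ->
  L2 S (fun x => \sum_(i <- s) c i * v i x).
Proof.
elim: s => [_|i s IH Lv]; first by under eq_fun do rewrite big_nil; exact: L2_0.
under eq_fun do rewrite big_cons.
apply: L2D; first by apply: L2Z; apply: Lv; rewrite mem_head.
by apply: IH => j js; apply: Lv; rewrite in_cons js orbT.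
Qed.

Lemma L2_mul_integrable (R : realType) (S : R) (v w : R -> R) :
  L2 S v -> L2 S w ->
  lebesgue_measure.-integrable (dom S) (EFin \o (fun x => v x * w x)).
Proof.
move=> [mv iv] [mw iw]; have i2 := integrableD (measurable_dom S) iv iw.
apply: (le_integrable (measurable_dom S) _ _ i2).
  by apply/measurable_EFinP; exact: measurable_funM.
move=> x _; rewrite -EFinD /= lee_fin [leRHS]ger0_norm ?addr_ge0 ?sqr_ge0//.
by rewrite ler_norml; apply/andP; split;
  have := sqr_ge0 (v x - w x); have := sqr_ge0 (v x + w x); nra.
Qed.

(** * Bilinearity of the inner product and the Cauchy-Schwarz inequality *)

Lemma eq_ip (R : realType) (S : R) (v v' w w' : R -> R) :
  {in dom S, v =1 v'} -> {in dom S, w =1 w'} -> ip S v w = ip S v' w'.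
Proof. by move=> vv' ww'; apply: eq_Rintegral => x xS; rewrite vv'// ww'. Qed.

Lemma ipC (R : realType) (S : R) (v w : R -> R) : ip S v w = ip S w v.
Proof. by apply: eq_Rintegral => x _; rewrite mulrC. Qed.

Lemma ipDl (R : realType) (S : R) (u v w : R -> R) :
  L2 S u -> L2 S v -> L2 S w ->
  ip S (fun x => u x + v x) w = ip S u w + ip S v w.
Proof.
move=> Lu Lv Lw; rewrite -RintegralD//; try exact: L2_mul_integrable.
by apply: eq_Rintegral => x _; rewrite mulrDl.
Qed.

Lemma ipZl (R : realType) (S c : R) (v w : R -> R) :
  L2 S v -> L2 S w -> ip S (fun x => c * v x) w = c * ip S v w.
Proof.
move=> Lv Lw; rewrite -RintegralZl//; last exact: L2_mul_integrable.
by apply: eq_Rintegral => x _; rewrite mulrA.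
Qed.

Lemma ipBl (R : realType) (S : R) (u v w : R -> R) :
  L2 S u -> L2 S v -> L2 S w ->
  ip S (fun x => u x - v x) w = ip S u w - ip S v w.
Proof.
move=> Lu Lv Lw; rewrite -RintegralB//; try exact: L2_mul_integrable.
by apply: eq_Rintegral => x _; rewrite mulrBl.
Qed.

Lemma ip_suml (R : realType) (S : R) (I : eqType) (s : seq I) (c : I -> R)
    (v : I -> R -> R) (w : R -> R) : (forall i, i \in s -> L2 S (v i)) ->
  L2 S w -> ip S (fun x => \sum_(i <- s) c i * v i x) w =
  \sum_(i <- s) c i * ip S (v i) w.
Proof.
move=> + Lw; elim: s => [_|i s IH Lv].
  by rewrite big_nil /ip; under eq_Rintegral do rewrite big_nil mul0r;
    rewrite Rintegral_cst// mul0r.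
under [X in ip _ X]eq_fun do rewrite big_cons.
have Lvi : L2 S (v i) by apply: Lv; rewrite mem_head.
have Lvs j : j \in s -> L2 S (v j) by move=> js; apply: Lv; rewrite in_cons js orbT.
rewrite big_cons ipDl//; [|exact: L2Z|exact: L2_sum].
by rewrite ipZl// IH.
Qed.

Lemma ip_ge0 (R : realType) (S : R) (v : R -> R) : 0 <= ip S v v.
Proof. by apply: Rintegral_ge0 => x _; rewrite -expr2 sqr_ge0. Qed.

Lemma norm0_ge0 (R : realType) (S : R) (v : R -> R) : 0 <= norm0 S v.
Proof. exact: sqrtr_ge0. Qed.

Lemma norm0_sqr (R : realType) (S : R) (v : R -> R) :
  norm0 S v ^+ 2 = ip S v v.
Proof. by rewrite sqr_sqrtr// ip_ge0. Qed.

Lemma ip_cauchy_schwarz (R : realType) (S : R) (v w : R -> R) :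
  L2 S v -> L2 S w -> `|ip S v w| <= norm0 S v * norm0 S w.
Proof.
move=> Lv Lw.
(* Expansion of [(v + t w, v + t w)]; a suitable [t] gives the inequality. *)
have H t : 0 <= ip S v v + 2 * t * ip S v w + t ^+ 2 * ip S w w.
  have Lt := L2Z t Lw; have := ip_ge0 S (fun x => v x + t * w x).
  rewrite ipDl//; last exact: L2D.
  rewrite ipC ipDl// (ipC _ _ (fun x => v x + t * w x)) ipDl//.
  rewrite (ipC _ v (fun x => t * w x)) !ipZl// (ipC _ w (fun x => t * w x)) ipZl//.
  by rewrite (ipC _ w v); congr (_ <= _); ring.
rewrite -ler_sqr ?nnegrE ?mulr_ge0 ?norm0_ge0// exprMn !norm0_sqr.
rewrite real_normK ?num_real//.
have [w0|w0] := eqVneq (ip S w w) 0.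
  have [->|B0] := eqVneq (ip S v w) 0; first by rewrite w0 mulr0 expr0n.
  (* Without quadratic term the expression is affine in [t]; this [t] would give it the value -1. *)
  have := H (- (ip S v v + 1) / (2 * ip S v w)); rewrite w0 mulr0 addr0.
  have -> : 2 * (- (ip S v v + 1) / (2 * ip S v w)) * ip S v w = - (ip S v v + 1).
    by field.
  by rewrite opprD addrA subrr sub0r oppr_ge0 ler10.
have w_gt0 : 0 < ip S w w by rewrite lt_neqAle eq_sym w0 ip_ge0.
(* The minimizer of the quadratic polynomial. *)
have := H (- ip S v w / ip S w w).
have -> : ip S v v + 2 * (- ip S v w / ip S w w) * ip S v w +
    (- ip S v w / ip S w w) ^+ 2 * ip S w w =
    (ip S v v * ip S w w - ip S v w ^+ 2) / ip S w w by field.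
by rewrite pmulr_lge0 ?invr_gt0// subr_ge0.
Qed.

Lemma eq_ip_ae (R : realType) (S : R) (v v' w : R -> R) :
  measurable_fun (dom S) v -> measurable_fun (dom S) v' ->
  measurable_fun (dom S) w ->
  {ae lebesgue_measure, forall x, dom S x -> v x = v' x} ->
  ip S v w = ip S v' w.
Proof.
move=> mv mv' mw vv'; congr fine; apply: ae_eq_integral => //.
- by apply/measurable_EFinP; exact: measurable_funM.
- by apply/measurable_EFinP; exact: measurable_funM.
- by apply: aeS vv' => x vv' /vv' ->.
Qed.

Lemma continuous_integrable_dom (R : realType) (S : R) (f : R -> R) :
  continuous f -> lebesgue_measure.-integrable (dom S) (EFin \o f).
Proof.
move=> cf; have iS : lebesgue_measure.-integrable `[0, S] (EFin \o f).
  apply: continuous_compact_integrable; first exact: segment_compact.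
  exact: continuous_subspaceT.
apply: (integrableS _ (measurable_dom S) _ iS); first exact: measurable_itv.
exact: subset_itv_oo_cc.
Qed.

Lemma norm0_le_bound (R : realType) (S c : R) (v : R -> R) :
  0 <= S -> 0 <= c -> L2 S v ->
  {ae lebesgue_measure, forall x, dom S x -> `|v x| <= c} ->
  norm0 S v <= c * Num.sqrt S.
Proof.
move=> S0 c0 [mv iv] vc.
rewrite -[c]ger0_norm// -sqrtr_sqr -sqrtrM ?sqr_ge0// ler_wsqrtr//.
have -> : c ^+ 2 * S = \int[lebesgue_measure]_(x in dom S) (c ^+ 2).
  have := lebesgue_measure_itv (`]0, S[ : interval R); rewrite /= lte_fin => muS.
  rewrite (Rintegral_cst _ (measurable_dom S)); congr (_ * _).
  rewrite -[LHS]/(fine S%:E); congr fine.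
  rewrite [RHS]muS; case: ltrP => [_|S0']; first by rewrite -EFinB subr0.
  by congr EFin; apply/eqP; rewrite eq_le S0'.
have ic : lebesgue_measure.-integrable (dom S) (EFin \o cst (c ^+ 2)).
  by apply: continuous_integrable_dom => x; exact: cvg_cst.
rewrite /ip /Rintegral fine_le//.
- by apply: integrable_fin_num => //; exact: L2_mul_integrable.
- exact: integrable_fin_num.
apply: ae_ge0_le_integral => //.
- by move=> x _; rewrite lee_fin -expr2 sqr_ge0.
- by apply/measurable_EFinP; exact: measurable_funM.
- by move=> x _; rewrite lee_fin sqr_ge0.
- apply: aeS vc => x vc /vc vcx; rewrite lee_fin -expr2 -(real_normK (num_real (v x))).
  by rewrite ler_sqr ?nnegrE.
Qed.

(** * Test functions *)

(** The recursion passes to [derive1 f], so induction on the order gives closure under sums,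
    products and affine substitutions without any formula for higher derivatives. *)
Fixpoint ndifferentiable (R : realType) (m : nat) (f : R -> R) : Prop :=
  if m is m'.+1 then
    (forall x, derivable f x 1) /\ ndifferentiable m' (derive1 f)
  else True.

Lemma ndifferentiableP (R : realType) (f : R -> R) :
  (forall m, ndifferentiable m f) <->
  forall m x, derivable (derive1n m f) x 1.
Proof.
split => [H m|H m].
  elim: m f H => [|m IH] f H; first by have [] := H 1%N.
  by rewrite derive1Sn; apply: IH => k; have [] := H k.+1.
elim: m f H => // m IH f H; split; first exact: H 0%N.
by apply: IH => k; rewrite -derive1Sn; exact: H.
Qed.

Lemma ndifferentiableS (R : realType) (m : nat) (f : R -> R) :
  ndifferentiable m.+1 f -> ndifferentiable m f.
Proof. by elim: m f => // m IH f [df /IH]. Qed.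

Lemma ndifferentiableD (R : realType) (m : nat) (f g : R -> R) :
  ndifferentiable m f -> ndifferentiable m g ->
  ndifferentiable m (fun x => f x + g x).
Proof.
elim: m f g => // m IH f g [df mf] [dg mg]; split.
  by move=> x; apply: derivableD.
rewrite (_ : derive1 _ = fun x => derive1 f x + derive1 g x); first exact: IH.
by apply/funext => x; rewrite !derive1E deriveD.
Qed.

Lemma ndifferentiableZ (R : realType) (m : nat) (c : R) (f : R -> R) :
  ndifferentiable m f -> ndifferentiable m (fun x => c * f x).
Proof.
elim: m f => // m IH f [df mf]; split.
  by move=> x; apply: derivableZ.
rewrite (_ : derive1 _ = fun x => c * derive1 f x); first exact: IH.
by apply/funext => x; rewrite !derive1E (deriveZ c (df x)).
Qed.

Lemma ndifferentiableM (R : realType) (m : nat) (f g : R -> R) :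
  ndifferentiable m f -> ndifferentiable m g ->
  ndifferentiable m (fun x => f x * g x).
Proof.
elim: m f g => // m IH f g Hf Hg; have [df mf] := Hf; have [dg mg] := Hg; split.
  by move=> x; apply: derivableM.
rewrite (_ : derive1 _ = fun x => f x * derive1 g x + g x * derive1 f x).
  by apply: ndifferentiableD; apply: IH => //; exact: ndifferentiableS.
by apply/funext => x; rewrite !derive1E deriveM.
Qed.

Lemma is_derive_affine (R : realType) (c e x df : R) (f : R -> R) :
  is_derive (c * x + e) 1 f df ->
  is_derive x 1 (fun y => f (c * y + e)) (c * df).
Proof.
move=> H; rewrite mulrC.
apply: (@is_derive1_comp _ f (fun y => c * y + e)).
apply: is_derive_eq; rewrite addr0 /GRing.scale /= mulr1 //.
Qed.

Lemma ndifferentiable_affine (R : realType) (m : nat) (c e : R) (f : R -> R) :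
  ndifferentiable m f -> ndifferentiable m (fun x => f (c * x + e)).
Proof.
elim: m f => // m IH f [df mf].
have H (x : R) : is_derive x 1 (fun y => f (c * y + e)) (c * derive1 f (c * x + e)).
  by apply: is_derive_affine; rewrite derive1E; exact: DeriveDef.
split; first by move=> x; have [] := H x.
rewrite (_ : derive1 _ = fun x => c * derive1 f (c * x + e)).
  by apply: ndifferentiableZ; exact: IH.
by apply/funext => x; rewrite derive1E (@derive_val _ _ _ _ _ _ _ (H x)).
Qed.

(** The classical smooth flat function is the case [n = 0]; the powers of [x^-1] make the linear
    span of the family stable under differentiation. *)
Definition flat_fun (R : realType) (n : nat) (x : R) : R :=
  if 0 < x then x^-1 ^+ n * expR (- x^-1) else 0.

Lemma flat_fun_ge0 (R : realType) (n : nat) (x : R) : 0 <= flat_fun n x.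
Proof.
rewrite /flat_fun; case: ifP => // x0.
by rewrite mulr_ge0 ?expR_ge0// exprn_ge0// invr_ge0 ltW.
Qed.

(** From [exp y >= y^(n+2)/(n+2)!] at [y = 1/x]. Quadratic decay is what makes the derivative at 0
    exist and vanish. *)
Lemma flat_fun_le (R : realType) (n : nat) (x : R) :
  flat_fun n x <= (n.+2)`!%:R * x ^+ 2.
Proof.
rewrite /flat_fun; case: ifP => [x0|_]; last by rewrite mulr_ge0// sqr_ge0.
have y0 : 0 < x^-1 by rewrite invr_gt0.
have := expR_ge1Dxn n.+1 (ltW y0) => H.
have {}H : x^-1 ^+ n.+2 / (n.+2)`!%:R <= expR x^-1.
  by apply: le_trans H; rewrite lerDr.
rewrite expRN ler_pdivrMr ?expR_gt0//.
have f0 : (0 : R) < (n.+2)`!%:R by rewrite ltr0n fact_gt0.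
have -> : x^-1 ^+ n = (n.+2)`!%:R * x ^+ 2 * (x^-1 ^+ n.+2 / (n.+2)`!%:R).
  rewrite (exprS _ n.+1) (exprS _ n); set Y := x^-1 ^+ n.
  by field; rewrite !gt_eqF.
by rewrite ler_wpM2l// mulr_ge0 ?sqr_ge0// ltW.
Qed.

Lemma is_derive_flat_fun (R : realType) (n : nat) (x : R) :
  is_derive x 1 (@flat_fun R n) (- n%:R * flat_fun n.+1 x + flat_fun n.+2 x).
Proof.
case: (ltgtP x 0) => [x0|x0|->].
- have E : \near x, cst 0 x = flat_fun n x.
    near=> y; rewrite /flat_fun ltNge (_ : y <= 0)//.
    have : y \in `]-oo, 0[ by near: y; apply: near_in_itvNyo; rewrite in_itv.
    by rewrite in_itv/= => /ltW.
  apply: near_eq_is_derive E _; rewrite /flat_fun ltNge (ltW x0)/= mulr0 addr0.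
  exact: is_derive_cst.
- have E : \near x, (x^-1 ^+ n * expR (- x^-1)) = flat_fun n x.
    near=> y; rewrite /flat_fun (_ : 0 < y)//.
    have : y \in `]0, +oo[ by near: y; apply: near_in_itvoy; rewrite in_itv/= x0.
    by rewrite in_itv/= andbT.
  apply: near_eq_is_derive E _; rewrite /flat_fun x0.
  have xn0 : x != 0 by rewrite gt_eqF.
  have dV : is_derive x 1 (fun y : R => y^-1) (- x^-1 ^+ 2).
    have := @is_deriveV R id x 1 1 xn0 (is_derive_id x 1).
    by rewrite /GRing.scale /= mulr1 exprVn.
  have dE : is_derive x 1 (fun y : R => expR (- y^-1)) (expR (- x^-1) * x^-1 ^+ 2).
    apply: (@is_derive1_comp _ expR (fun y => - y^-1)).
    by apply: is_derive_eq; rewrite opprK.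
  have dX : is_derive x 1 (fun y : R => y^-1 ^+ n)
      (n%:R * x^-1 ^+ n.-1 * - x^-1 ^+ 2).
    have := is_deriveX n dV; rewrite /GRing.scale /=; congr is_derive.
    by apply/funext => y; rewrite exprfctE.
  apply: is_derive_eq; rewrite /GRing.scale /=.
  (* The power rule involves [n.-1], so [n = 0] is separated. *)
  case: n {dX} => [|n] /=; first by rewrite expr0; ring.
  rewrite !exprS expr0; ring.
- rewrite /flat_fun ltxx mulr0 addr0.
  (* At 0 the announced derivative is 0; the difference quotient is at most [(n+2)! |h|] in absolute
     value. *)
  suff H : h^-1 *: (flat_fun n (h *: 1 + 0 : R) - flat_fun n 0)
      @[h --> (0:R)^'] --> (0:R).
    by apply: DeriveDef; [apply/cvg_ex; exists 0|apply/cvg_lim].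
  apply/cvgrPdist_le => /= e e0.
  have f0 : (0 : R) < (n.+2)`!%:R by rewrite ltr0n fact_gt0.
  near=> h.
  rewrite sub0r normrN addr0 /GRing.scale /= mulr1 {2}/flat_fun ltxx subr0.
  have h0 : h != 0 by near: h; exact: nbhs_dnbhs_neq.
  rewrite normrM normfV ler_pdivrMl ?normr_gt0//.
  rewrite ger0_norm ?flat_fun_ge0//; apply: le_trans (flat_fun_le _ _) _.
  rewrite -(real_normK (num_real h)) expr2 mulrCA ler_wpM2l//.
  rewrite mulrC -ler_pdivlMr//; near: h.
  by apply: dnbhs0_le; exact: divr_gt0.
Unshelve. all: by end_near. Qed.

Lemma ndifferentiable_flat_fun (R : realType) (m n : nat) :
  ndifferentiable m (@flat_fun R n).
Proof.
elim: m n => // m IH n; split; first by move=> x; have [] := is_derive_flat_fun n x.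
rewrite (_ : derive1 _ = fun x => - n%:R * flat_fun n.+1 x + flat_fun n.+2 x).
  by apply: ndifferentiableD => //; exact: ndifferentiableZ.
apply/funext => x; rewrite derive1E.
exact: (@derive_val _ _ _ _ _ _ _ (is_derive_flat_fun n x)).
Qed.

(** With [m = n.+1], the function [exp(-1/(m(x-a)) - 1/(m(b-x)))] on []a, b[], extended by 0. As a
    product of flat functions of affine arguments it is smooth by the closure lemmas. *)
Definition bump (R : realType) (a b : R) (n : nat) (x : R) : R :=
  flat_fun 0 (n.+1%:R * x + - (n.+1%:R * a)) *
  flat_fun 0 (- n.+1%:R * x + n.+1%:R * b).

Lemma bumpE (R : realType) (a b : R) (n : nat) (x : R) : bump a b n x =
  if a < x < b then expR (- (n.+1%:R * (x - a))^-1) *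
                    expR (- (n.+1%:R * (b - x))^-1) else 0.
Proof.
rewrite /bump /flat_fun !expr0 !mul1r -mulrBr.
have -> : - n.+1%:R * x + n.+1%:R * b = n.+1%:R * (b - x) by ring.
rewrite !pmulr_rgt0 ?subr_gt0//.
by case: (a < x); case: (x < b); rewrite ?mulr0 ?mul0r.
Qed.

Lemma bump_norm_le1 (R : realType) (a b : R) (n : nat) (x : R) :
  `|bump a b n x| <= 1.
Proof.
rewrite bumpE; case: ifP => [/andP[ax xb]|_]; last by rewrite normr0.
rewrite ger0_norm ?mulr_ge0 ?expR_ge0// mulr_ile1 ?expR_ge0// expR_le1 oppr_le0.
  by rewrite invr_ge0 mulr_ge0// subr_ge0 ltW.
by rewrite invr_ge0 mulr_ge0// subr_ge0 ltW.
Qed.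

Lemma bump_cvg (R : realType) (a b x : R) :
  bump a b n x @[n --> \oo] --> (\1_`]a, b[ x : R).
Proof.
rewrite indicE; case: (boolP (a < x < b)) => axb; last first.
  rewrite memNset; last by rewrite /= in_itv; exact/negP.
  by under eq_cvg do rewrite bumpE (negbTE axb); exact: cvg_cst.
rewrite mem_set; last by rewrite /= in_itv.
under eq_cvg do rewrite bumpE axb.
have H (c : R) : 0 < c -> expR (- (n.+1%:R * c)^-1) @[n --> \oo] --> (1 : R).
  move=> c0; rewrite -[in X in _ --> X](@expR0 R).
  apply: continuous_cvg; first exact: continuous_expR.
  rewrite -oppr0; apply: cvgN; rewrite -[X in _ --> X](mul0r c^-1).
  under eq_cvg do rewrite invfM.
  apply: cvgM; last exact: cvg_cst.
  exact: cvg_harmonic.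
case/andP: axb => ax xb; rewrite -[1%:R](mulr1 1).
by apply: cvgM; apply: H; rewrite subr_gt0.
Qed.

Lemma bump_test_function (R : realType) (S a b : R) (n : nat) :
  0 < a -> b < S -> test_function S (bump a b n).
Proof.
move=> a0 bS.
have sub : closure [set x | bump a b n x != 0] `<=` `[a, b].
  have /closure_id -> : closed `[a, b]%classic by exact: itv_closed.
  apply: closure_subset => x /=; rewrite bumpE in_itv/=.
  by case: ifP => [/andP[/ltW -> /ltW ->]//|_]; rewrite eqxx.
split.
- apply/ndifferentiableP => m.
  by apply: ndifferentiableM; apply: ndifferentiable_affine;
    exact: ndifferentiable_flat_fun.
- apply: subclosed_compact sub; [exact: closed_closure|exact: segment_compact].
- move=> x /sub; rewrite /dom /= !in_itv/= => /andP[ax xb].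
  by rewrite (lt_le_trans a0)//= (le_lt_trans xb).
Qed.

(** * Square-integrability of test functions, and orthogonality to all of them *)

Lemma derivable_continuous (R : realType) (f : R -> R) :
  (forall x, derivable f x 1) -> continuous f.
Proof. by move=> df x; apply/differentiable_continuous/derivable1_diffP. Qed.

Lemma continuous_L2 (R : realType) (S : R) (f : R -> R) :
  continuous f -> L2 S f.
Proof.
move=> cf; split.
  by apply: measurable_funTS; exact: continuous_measurable_fun.
apply: (@continuous_integrable_dom _ _ (fun x => f x ^+ 2)) => x.
by apply: cvgM; exact: cf.
Qed.

Lemma test_function_L2 (R : realType) (S : R) (phi : R -> R) :
  test_function S phi -> L2 S phi.
Proof.
by move=> [dphi _ _]; apply/continuous_L2/derivable_continuous; exact: dphi 0%N.
Qed.

Lemma derive_test_function_L2 (R : realType) (S : R) (phi : R -> R) :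
  test_function S phi -> L2 S (derive1 phi).
Proof.
by move=> [dphi _ _]; apply/continuous_L2/derivable_continuous; exact: dphi 1%N.
Qed.

Lemma derive_test_functionB (R : realType) (S : R) (phi psi : R -> R) :
  test_function S phi -> test_function S psi ->
  derive1 (fun x => phi x - psi x) = fun x => derive1 phi x - derive1 psi x.
Proof.
move=> [dphi _ _] [dpsi _ _]; apply/funext => x; rewrite !derive1E.
by rewrite deriveB//; [exact: dphi 0%N x|exact: dpsi 0%N x].
Qed.

Lemma test_functionB (R : realType) (S : R) (phi psi : R -> R) :
  test_function S phi -> test_function S psi ->
  test_function S (fun x => phi x - psi x).
Proof.
move=> [/ndifferentiableP dphi cphi sphi] [/ndifferentiableP dpsi cpsi spsi].
have sub : closure [set x | phi x - psi x != 0] `<=`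
    closure [set x | phi x != 0] `|` closure [set x | psi x != 0].
  rewrite -closureU; apply: closure_subset => x /= xn0.
  have [p0|] := eqVneq (phi x) 0; last by left.
  by right; apply: contraNneq xn0 => ->; rewrite p0 subrr.
split.
- apply/ndifferentiableP => m; have := ndifferentiableD (dphi m)
    (ndifferentiableZ (-1) (dpsi m)).
  by congr ndifferentiable; apply/funext => x; rewrite mulN1r.
- apply: subclosed_compact sub; first exact: closed_closure.
  exact: compactU.
- by move=> x /sub[/sphi|/spsi].
Qed.

(** [dom S] is bounded, so the constant 1 is square-integrable and can serve as second factor. *)
Lemma L2_integrable (R : realType) (S : R) (v : R -> R) : L2 S v ->
  lebesgue_measure.-integrable (dom S) (EFin \o v).
Proof.
move=> Lv; have L1 : L2 S (fun=> 1) by apply: continuous_L2 => x; exact: cvg_cst.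
have := L2_mul_integrable Lv L1.
by congr (integrable _ _ _); apply/funext => x /=; rewrite mulr1.
Qed.

(** The bumps are test functions, are bounded by 1 and tend to the indicator of []a, b[]; dominated
    convergence with majorant [|z|] passes orthogonality to the limit. *)
Lemma orthogonal_test_itv (R : realType) (S a b : R) (z : R -> R) : L2 S z ->
  (forall phi, test_function S phi -> ip S z phi = 0) ->
  0 < a -> b < S -> \int[lebesgue_measure]_(x in `]a, b[) z x = 0.
Proof.
move=> Lz zphi a0 bS; have iz := L2_integrable Lz; have [mz _] := Lz.
have sub : `]a, b[ `<=` dom S.
  move=> x; rewrite /dom /= !in_itv/= => /andP[ax xb].
  by rewrite (lt_trans a0 ax) (lt_trans xb bS).
have mbump n : measurable_fun (dom S) (bump a b n).
  by have [] := test_function_L2 (bump_test_function n a0 bS).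
pose f_ n x := (z x * bump a b n x)%:E.
have mf_ n : measurable_fun (dom S) (f_ n).
  by apply/measurable_EFinP; exact: measurable_funM.
have f_E n : (\int[lebesgue_measure]_(x in dom S) f_ n x = 0)%E.
  have Lb := test_function_L2 (bump_test_function n a0 bS).
  have := zphi _ (bump_test_function n a0 bS); rewrite /ip /Rintegral => E.
  (* The hypothesis concerns a real-valued integral; finiteness transfers it to the extended
     reals. *)
  rewrite -[LHS]fineK; first by rewrite E.
  exact: (integrable_fin_num (measurable_dom S) (L2_mul_integrable Lz Lb)).
have mf : measurable_fun (dom S) (EFin \o (z \_ `]a, b[)).
  apply/measurable_EFinP; apply/measurable_restrict => //; first exact: measurable_itv.
  apply: measurable_funS mz; first exact: measurable_itv.
  exact: subIsetl.
have f_f x : dom S x -> f_ n x @[n --> \oo] --> (EFin \o (z \_ `]a, b[)) x.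
  move=> _; rewrite /f_ /=; apply: cvg_EFin; first by apply: nearW.
  rewrite [X in _ --> X](_ : _ = z x * \1_`]a, b[ x); last first.
    by rewrite patchE indicE; case: ifP; rewrite ?mulr1 ?mulr0.
  by apply: cvgM; [exact: cvg_cst|exact: bump_cvg].
have f_z n x : dom S x -> (`|f_ n x| <= `|z x|%:E)%E.
  by move=> _; rewrite lee_fin normrM ler_piMr// bump_norm_le1.
have f_fae : {ae @lebesgue_measure R, forall x, dom S x ->
    f_ n x @[n --> \oo] --> (EFin \o (z \_ `]a, b[)) x} by exact: aeW.
have f_zae : {ae @lebesgue_measure R, forall x n, dom S x ->
    (`|f_ n x| <= `|z x|%:E)%E} by apply: aeW => x n; exact: f_z.
have [_ _] := dominated_convergence (measurable_dom S) mf_ mf f_fae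
  (integrable_norm iz) f_zae.
set I := (X in _ --> X) => cvgI.
have {}cvgI : cst 0%E n @[n --> \oo] --> I.
  apply: cvg_trans cvgI; apply: near_eq_cvg; apply: nearW => n.
  exact: (f_E n).
have I0 : I = 0%E := cvg_unique (@ereal_hausdorff R) cvgI (cvg_cst 0%E).
rewrite -[in LHS](setIidr sub) Rintegral_mkcondr /Rintegral.
by rewrite -[RHS]/(fine 0%E) -I0.
Qed.

(** * Weak derivatives *)

(* Up to a null set, z is the derivative of its indefinite integral, which is
   constant on Lambda. *)
Lemma orthogonal_test_ae0 (R : realType) (S : R) (z : R -> R) : L2 S z ->
  (forall phi, test_function S phi -> ip S z phi = 0) ->
  {ae lebesgue_measure, forall x, dom S x -> z x = 0}.
Proof.
move=> Lz zphi; have iz := L2_integrable Lz.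
have itv0 a b : 0 < a -> b < S -> \int[lebesgue_measure]_(x in `]a, b[) z x = 0.
  exact: orthogonal_test_itv.
have loc : locally_integrable [set: R] (z \_ (dom S)).
  by apply: integrable_locally iz; exact: measurable_itv.
have intz : lebesgue_measure.-integrable [set: R] (EFin \o (z \_ (dom S))).
  rewrite -restrict_EFin; apply/integrable_restrict => //.
  by rewrite setTI.
have inty y : lebesgue_measure.-integrable `]-oo, y] (EFin \o (z \_ (dom S))).
  by apply: integrableS intz => //; exact: measurable_itv.
have /= := FTC1Ny inty loc.
apply: aeS => x [_ dF] Sx; have := dF; rewrite patchE mem_set// => <-.
set F := (X in derive1 X).
(* For [x <= y], [F y - F x] is the integral of [z] over []x, y[], which vanishes by [itv0]. *)
have Fc y : dom S y -> F y = F x.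
  move: x y {dF} Sx.
  suff H x y : dom S x -> dom S y -> x <= y -> F y = F x.
    move=> x y Sx Sy; have [xy|/ltW yx] := leP x y; first exact: H.
    by apply/esym; exact: H.
  move=> Sx Sy xy; apply/eqP; rewrite -subr_eq0 /F; apply/eqP.
  rewrite Rintegral_itvB//.
  have /andP[x0 xS] : 0 < x < S by move: Sx; rewrite /dom/= in_itv.
  have /andP[y0 yS] : 0 < y < S by move: Sy; rewrite /dom/= in_itv.
  rewrite -Rintegral_itv_bndo_bndc; last first.
    by apply: integrableS intz => //; exact: measurable_itv.
  rewrite -(itv0 x y x0 yS); apply: eq_Rintegral => t.
  rewrite inE/= in_itv/= => /andP[xt ty]; rewrite patchE mem_set//.
  by rewrite /dom /= in_itv/= (lt_trans x0)// (lt_trans ty).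
rewrite derive1E (@near_eq_derive _ _ _ F (cst (F x))).
  exact: derive_cst.
near=> y; apply: Fc; rewrite /dom/=; near: y; apply: near_in_itvoo.
exact: Sx.
Unshelve. all: by end_near. Qed.

Lemma ipBr (R : realType) (S : R) (u v w : R -> R) :
  L2 S u -> L2 S v -> L2 S w ->
  ip S w (fun x => u x - v x) = ip S w u - ip S w v.
Proof. by move=> Lu Lv Lw; rewrite ipC ipBl// !(ipC _ w). Qed.

Lemma norm0B_le (R : realType) (S : R) (v w : R -> R) : L2 S v -> L2 S w ->
  norm0 S (fun x => v x - w x) <= norm0 S v + norm0 S w.
Proof.
move=> Lv Lw; rewrite -ler_sqr ?nnegrE ?addr_ge0 ?norm0_ge0//.
have LB := L2B Lv Lw; rewrite sqrrD !norm0_sqr ipBl// !ipBr// (ipC _ w v).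
have := ip_cauchy_schwarz Lv Lw; rewrite ler_norml => /andP[CS _].
by lra.
Qed.

Lemma eq_norm0_ae (R : realType) (S : R) (v w : R -> R) :
  L2 S v -> L2 S w ->
  {ae lebesgue_measure, forall x, dom S x -> v x = w x} ->
  norm0 S v = norm0 S w.
Proof.
move=> [mv _] [mw _] vw; congr Num.sqrt.
by rewrite (eq_ip_ae mv mw mv vw) ipC (eq_ip_ae mv mw mw vw).
Qed.

Lemma wD_weak_derivative (R : realType) (S : R) (v : R -> R) : H1 S v ->
  L2 S (wD S v) /\ weak_derivative S v (wD S v).
Proof. by move=> [_ [w wv]]; exact: (@xgetPex _ _ [set w | _] (ex_intro _ w wv)). Qed.

Lemma weak_derivative_unique (R : realType) (S : R) (v w1 w2 : R -> R) :
  L2 S w1 -> L2 S w2 -> weak_derivative S v w1 -> weak_derivative S v w2 ->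
  {ae lebesgue_measure, forall x, dom S x -> w1 x = w2 x}.
Proof.
move=> L1 L2 D1 D2; have LB := L2B L1 L2.
have : {ae lebesgue_measure, forall x, dom S x -> w1 x - w2 x = 0}.
  apply: (orthogonal_test_ae0 LB) => phi tphi.
  rewrite ipBl//; last exact: test_function_L2.
  by apply/eqP; rewrite subr_eq0 -eqr_opp -D1// -D2.
by apply: aeS => x H /H /eqP; rewrite subr_eq0 => /eqP.
Qed.

Lemma weak_derivativeB (R : realType) (S : R) (v w : R -> R) :
  H1 S v -> H1 S w ->
  weak_derivative S (fun x => v x - w x) (fun x => wD S v x - wD S w x).
Proof.
move=> Hv Hw phi tphi.
have [Lv _] := Hv; have [Lw _] := Hw.
have [Ldv Dv] := wD_weak_derivative Hv; have [Ldw Dw] := wD_weak_derivative Hw.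
have Lphi := test_function_L2 tphi; have Ldphi := derive_test_function_L2 tphi.
by rewrite !ipBl// Dv// Dw// opprB opprK addrC.
Qed.

Lemma H1B (R : realType) (S : R) (v w : R -> R) :
  H1 S v -> H1 S w -> H1 S (fun x => v x - w x).
Proof.
move=> Hv Hw; split; first exact: L2B Hv.1 Hw.1.
exists (fun x => wD S v x - wD S w x); split; last exact: weak_derivativeB.
exact: L2B (wD_weak_derivative Hv).1 (wD_weak_derivative Hw).1.
Qed.

(** [wD] selects each representative independently, so additivity is only an identity up to a null
    set, obtained from uniqueness. *)
Lemma wDB_ae (R : realType) (S : R) (v w : R -> R) : H1 S v -> H1 S w ->
  {ae lebesgue_measure, forall x, dom S x ->
    wD S (fun x => v x - w x) x = wD S v x - wD S w x}.
Proof.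
move=> Hv Hw; have [LB DB] := wD_weak_derivative (H1B Hv Hw).
have LL := L2B (wD_weak_derivative Hv).1 (wD_weak_derivative Hw).1.
exact: (weak_derivative_unique LB LL DB (weak_derivativeB Hv Hw)).
Qed.

Lemma H10B (R : realType) (S : R) (v w : R -> R) :
  H10 S v -> H10 S w -> H10 S (fun x => v x - w x).
Proof.
move=> [Hv av] [Hw aw]; split; first exact: H1B.
move=> e e0; have e20 : 0 < e / 2 by rewrite divr_gt0.
have [phi [tphi pv dpv]] := av _ e20; have [psi [tpsi pw dpw]] := aw _ e20.
have [Lphi Lpsi] := (test_function_L2 tphi, test_function_L2 tpsi).
have [Ldphi Ldpsi] := (derive_test_function_L2 tphi, derive_test_function_L2 tpsi).
have [Lv _] := Hv; have [Lw _] := Hw.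
have [Ldv _] := wD_weak_derivative Hv; have [Ldw _] := wD_weak_derivative Hw.
have [Ldd _] := wD_weak_derivative (H1B Hv Hw).
exists (fun x => phi x - psi x); split; first exact: test_functionB.
- rewrite (_ : (fun x => _) = fun x => (v x - phi x) - (w x - psi x)); last first.
    by apply/funext => x; ring.
  apply: le_lt_trans (norm0B_le (L2B Lv Lphi) (L2B Lw Lpsi)) _.
  by rewrite (splitr e); exact: (ltrD pv pw).
- rewrite (derive_test_functionB tphi tpsi).
  rewrite (@eq_norm0_ae _ _ _
    (fun x => (wD S v x - derive1 phi x) - (wD S w x - derive1 psi x))).
  + apply: le_lt_trans (norm0B_le (L2B Ldv Ldphi) (L2B Ldw Ldpsi)) _.
    by rewrite (splitr e); exact: (ltrD dpv dpw).
  + exact: L2B Ldd (L2B Ldphi Ldpsi).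
  + exact: L2B (L2B Ldv Ldphi) (L2B Ldw Ldpsi).
  + by apply: aeS (wDB_ae Hv Hw) => x H /H ->; ring.
Qed.

(** For test functions this is the definition of the weak derivative of [w]; density of test
    functions and Cauchy-Schwarz extend it to [v]. *)
Lemma H1_H10_by_parts (R : realType) (S : R) (v w : R -> R) :
  H10 S v -> H1 S w -> ip S (wD S w) v = - ip S w (wD S v).
Proof.
move=> [Hv av] Hw; have [Lv _] := Hv; have [Lw _] := Hw.
have [Ldv _] := wD_weak_derivative Hv; have [Ldw Dw] := wD_weak_derivative Hw.
apply/eqP; rewrite -subr_eq0 opprK -normr_le0; apply/ler_addgt0Pl => e e0.
(* The summand 1 makes [K] positive; approximating [v] within [e / K] then keeps the defect below
   [e]. *)
rewrite addr0; set K := norm0 S (wD S w) + norm0 S w + 1.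
have K0 : 0 < K by rewrite ltr_wpDl// addr_ge0 ?norm0_ge0.
have [phi [tphi pv dpv]] := av _ (divr_gt0 e0 K0).
have Lphi := test_function_L2 tphi; have Ldphi := derive_test_function_L2 tphi.
have -> : ip S (wD S w) v + ip S w (wD S v) =
    ip S (wD S w) (fun x => v x - phi x) +
    ip S w (fun x => wD S v x - derive1 phi x).
  by rewrite !ipBr// (Dw _ tphi); ring.
apply: le_trans (ler_normD _ _) _.
apply: le_trans (lerD (ip_cauchy_schwarz Ldw (L2B Lv Lphi))
  (ip_cauchy_schwarz Lw (L2B Ldv Ldphi))) _.
apply: (@le_trans _ _ ((norm0 S (wD S w) + norm0 S w) * (e / K))).
  by rewrite mulrDl lerD// ler_wpM2l ?norm0_ge0// ltW.
rewrite mulrCA -[leRHS]mulr1; apply: ler_wpM2l; first exact: ltW.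
by rewrite ler_pdivrMr// mul1r lerDl.
Qed.

(** * Error estimate *)

Lemma norm1_sqr (R : realType) (S kap : R) (v : R -> R) : 0 <= kap ->
  norm1 S kap v ^+ 2 = ip S v v + kap * ip S (wD S v) (wD S v).
Proof.
by move=> k0; rewrite sqr_sqrtr ?norm0_sqr// addr_ge0 ?ip_ge0// mulr_ge0 ?ip_ge0.
Qed.

Lemma norm0_le_norm1 (R : realType) (S kap : R) (v : R -> R) : 0 <= kap ->
  norm0 S v <= norm1 S kap v.
Proof.
move=> k0; rewrite -[leLHS]ger0_norm ?norm0_ge0// -sqrtr_sqr ler_wsqrtr//.
by rewrite lerDl mulr_ge0// sqr_ge0.
Qed.

(** The first step fits the general formula, its sum being empty and [zeta] at [(1, 1)] being 1. *)
Lemma semidiscrete_solution_eq (R : realType) (T S : R) (n : nat)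
    (d a : nat -> R) (A : R) (f : R -> R -> R) (phi : R -> R) (N k : nat)
    (U : nat -> R -> R) (v : R -> R) (dt := T / N%:R) :
  admissible_data n d a A -> 0 < dt ->
  semidiscrete_solution T S n d a f phi N U -> (1 <= k <= N)%N -> H10 S v ->
  ip S (U k) v + kappa n d a dt * ip S (wD S (U k)) (wD S v) =
  \sum_(1 <= j < k) (zeta n d a dt j.+1 k - zeta n d a dt j k) * ip S (U j) v
  + zeta n d a dt 1 k * ip S (U 0%N) v + kappa n d a dt * ip S (f ^~ (k%:R * dt)) v.
Proof.
move=> H dt0 [_ _ U1 Uk] /andP[k1 kN] Hv.
have [kE|k1'] := eqVneq k 1%N; last first.
  by apply: Uk => //; rewrite kN andbT ltn_neqAle eq_sym k1'.
rewrite kE big_geq// add0r (zetakk 0 H dt0) mul1r; apply: U1 => //.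
exact: leq_trans kN.
Qed.

(** The differential equation replaces the Caputo-Fabrizio sum and [kappa_sum_Fop] the discrete one.
    The right-hand side is built from square-integrable functions, so it can be tested. *)
Lemma exact_solution_residual (R : realType) (T S : R) (n : nat)
    (d a : nat -> R) (A : R) (f : R -> R -> R) (phi : R -> R) (u : R -> R -> R)
    (dt : R) (k : nat) (uk := fun j x => u x (j%:R * dt)) :
  admissible_data n d a A -> 0 < dt -> (0 < k)%N -> k%:R * dt <= T ->
  exact_solution T S n d a f phi u ->
  {ae lebesgue_measure, forall x, dom S x ->
    Rtilde n d a dt u k x =
    kappa n d a dt * (wD S (wD S (uk k)) x + f x (k%:R * dt)) - uk k x +
    (\sum_(1 <= j < k) (zeta n d a dt j.+1 k - zeta n d a dt j k) * uk j x +
     zeta n d a dt 1 k * uk 0%N x)}.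
Proof.
move=> H dt0 k0 kT [ae_eq _ _].
have tk : 0 < k%:R * dt <= T by rewrite kT mulr_gt0// ltr0n.
apply: aeS (ae_eq _ tk) => x eqx /eqx {}eqx; rewrite /Rtilde.
under eq_bigr do rewrite mulrBr.
rewrite sumrB eqx mulrBr (kappa_sum_Fop (fun j => u x (j%:R * dt)) H dt0 k0).
by rewrite opprB addrA addrAC.
Qed.

(* The residual r replaces the truncation error, whose measurability is only
   known up to a null set. *)
Lemma error_equation (R : realType) (T S : R) (n : nat)
    (d a : nat -> R) (A : R) (f : R -> R -> R) (phi : R -> R) (u : R -> R -> R)
    (N k : nat) (U : nat -> R -> R) (C : R)
    (dt := T / N%:R) (uk := fun j x => u x (j%:R * dt)) :
  0 < T -> 0 <= S -> admissible_data n d a A ->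
  (forall t, 0 <= t <= T -> L2 S (f ^~ t)) ->
  (forall t, 0 <= t <= T -> H2 S (u ^~ t) /\ H10 S (u ^~ t)) ->
  exact_solution T S n d a f phi u ->
  semidiscrete_solution T S n d a f phi N U -> (0 < k <= N)%N -> 0 <= C ->
  (forall x, dom S x -> `|Rtilde n d a dt u k x| <= C) ->
  exists2 r : R -> R, L2 S r /\ norm0 S r <= C * Num.sqrt S &
  forall v, H10 S v -> let e j x := uk j x - U j x in
    ip S (e k) v + kappa n d a dt * ip S (wD S (e k)) (wD S v) =
    \sum_(1 <= j < k) (zeta n d a dt j.+1 k - zeta n d a dt j k) * ip S (e j) v
    - ip S r v.
Proof.
move=> T0 S0 H fL2 uH hu hU kN C0 RC; have /andP[k0 kN'] := kN.
have N0 : (0 : R) < N%:R by rewrite ltr0n (leq_trans k0).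
have dt0 : 0 < dt by rewrite divr_gt0.
have jT j : (j <= N)%N -> 0 <= j%:R * dt <= T.
  move=> jN; apply/andP; split; first by apply: mulr_ge0 => //; exact: ltW.
  rewrite /dt mulrCA ger_pMr//.
  by rewrite ler_pdivrMr// mul1r ler_nat.
have Luk j : (j <= N)%N -> L2 S (uk j) by move=> /jT /uH[[[]]].
have HU j : (0 < j <= N)%N -> H10 S (U j) by case: hU => _ h _ _ /h.
have LU j : (0 < j <= N)%N -> L2 S (U j) by move=> /HU[[]].
have /andP[_ kT] := jT _ kN'.
have [[Huk HDuk] H10uk] := uH _ (jT _ kN').
have [LDDu _] := wD_weak_derivative HDuk.
have Lfk := fL2 _ (jT _ kN').
set z := zeta n d a dt; set kap := kappa n d a dt.
pose w j := z j.+1 k - z j k.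
have jk j : j \in index_iota 1 k -> (0 < j <= N)%N.
  by rewrite mem_index_iota => /andP[-> /ltnW jk]; exact: leq_trans kN'.
have Ls : L2 S (fun x => \sum_(1 <= j < k) w j * uk j x).
  by apply: L2_sum => j /jk /andP[_]; exact: Luk.
pose g x := kap * (wD S (wD S (uk k)) x + f x (k%:R * dt)).
have Lg : L2 S g by apply: L2Z; exact: L2D.
pose h x := \sum_(1 <= j < k) w j * uk j x + z 1%N k * uk 0%N x.
have Lz0 : L2 S (fun x => z 1%N k * uk 0%N x) by apply: L2Z; exact: Luk.
have Lh : L2 S h by exact: L2D.
have Lgu : L2 S (fun x => g x - uk k x) by apply: L2B => //; exact: Luk.
pose r x := (g x - uk k x) + h x.
have Lr : L2 S r by exact: L2D.
exists r; first split=> //.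
  apply: norm0_le_bound => //.
  apply: aeS (exact_solution_residual H dt0 k0 kT hu) => x rx Sx.
  by rewrite /r -rx// RC.
move=> v Hv e; have [[Lv _] _] := Hv; have [LDv _] := wD_weak_derivative Hv.1.
have HUk := HU _ kN; have [LDU _] := wD_weak_derivative HUk.1.
have [LDu _] := wD_weak_derivative Huk.
have [LDe _] := wD_weak_derivative (H1B Huk HUk.1).
(* The inner product ignores the null set on which [wD] may fail to be additive. *)
have -> : ip S (wD S (e k)) (wD S v) =
    ip S (wD S (uk k)) (wD S v) - ip S (wD S (U k)) (wD S v).
  rewrite -ipBl//; apply: eq_ip_ae; [exact: LDe.1|exact: (L2B LDu LDU).1|exact: LDv.1|].
  exact: wDB_ae Huk HUk.1.
(* Integration by parts moves one derivative of the second space derivative onto [v]. *)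
have -> : ip S r v = kap * (- ip S (wD S (uk k)) (wD S v) + ip S (f ^~ (k%:R * dt)) v)
   - ip S (uk k) v +
   (\sum_(1 <= j < k) w j * ip S (uk j) v + z 1%N k * ip S (uk 0%N) v).
  rewrite ipDl// ipBl//; last exact: Luk.
  rewrite ipZl//; last exact: L2D.
  rewrite ipDl// (H1_H10_by_parts Hv HDuk) ipDl// ipZl//; last exact: Luk.
  by rewrite ip_suml// => j /jk /andP[_]; exact: Luk.
have E : ip S (U k) v + kap * ip S (wD S (U k)) (wD S v) =
    \sum_(1 <= j < k) w j * ip S (U j) v + z 1%N k * ip S (U 0%N) v +
    kap * ip S (f ^~ (k%:R * dt)) v := semidiscrete_solution_eq H dt0 hU kN Hv.
(* Both solutions start from [phi], so the initial terms cancel in the error. *)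
have U0 : ip S (U 0%N) v = ip S (uk 0%N) v.
  apply: eq_ip => // x; rewrite inE => Sx; case: hU hu => -> // _ _ _ [_ + _].
  by move=> <- //; rewrite /uk mul0r.
rewrite {}U0 in E.
rewrite [X in _ = X - _](eq_big_seq
  (fun j => w j * ip S (uk j) v - w j * ip S (U j) v)).
  rewrite sumrB ipBl//; [|exact: Luk|exact: LU].
  move: E; move: (ip S (f ^~ _) v) (ip S (uk 0%N) v) (ip S (uk k) v) (ip S (U k) v)
    (ip S (wD S (uk k)) _) (ip S (wD S (U k)) _)
    (\sum_(1 <= j < k) w j * ip S (uk j) v) (\sum_(1 <= j < k) w j * ip S (U j) v).
  move=> fv u0v ukv Ukv Du DU s1 s2 E.
  have -> : Ukv = s2 + z 1%N k * u0v + kap * fv - kap * DU by rewrite -E addrK.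
  ring.
by move=> j /jk jN; rewrite ipBl ?mulrBr//; [apply: Luk; case/andP: jN|exact: LU].
Qed.

(** [discrete_stability] applied to the norms of the errors, with [rho] the bound [C * Num.sqrt S]
    on the norm of the residual. *)
Lemma error_bound (R : realType) (T S : R) (n : nat)
    (d a : nat -> R) (A : R) (f : R -> R -> R) (phi : R -> R) (u : R -> R -> R)
    (N : nat) (U : nat -> R -> R) (C : R) (dt := T / N%:R) :
  0 < T -> 0 <= S -> admissible_data n d a A ->
  (forall t, 0 <= t <= T -> L2 S (f ^~ t)) ->
  (forall t, 0 <= t <= T -> H2 S (u ^~ t) /\ H10 S (u ^~ t)) ->
  exact_solution T S n d a f phi u ->
  semidiscrete_solution T S n d a f phi N U -> 0 <= C ->
  (forall k, (0 < k <= N)%N ->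
    forall x, dom S x -> `|Rtilde n d a dt u k x| <= C) ->
  forall k, (0 < k <= N)%N ->
    norm1 S (kappa n d a dt) (fun x => u x (k%:R * dt) - U k x) <=
    C * Num.sqrt S / zeta n d a dt 1 k.
Proof.
move=> T0 S0 H fL2 uH hu hU C0 RC k kN.
have N0 : (0 : R) < N%:R by rewrite ltr0n; case/andP: kN => k0; exact: leq_trans.
have dt0 : 0 < dt by rewrite divr_gt0.
have kap0 := kappa_gt0 H dt0.
pose e j x := u x (j%:R * dt) - U j x.
apply: (@discrete_stability _ (zeta n d a dt)
  (fun j => norm1 S (kappa n d a dt) (e j)) _ N) => //.
- by rewrite mulr_ge0// sqrtr_ge0.
- by move=> j /andP[j0 _]; exact: zeta1_gt0 H dt0 j0.
- by case=> // j _; exact: zetakk H dt0.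
- by move=> i j ij _; exact: zeta1_le H dt0 ij.
- move=> i j /andP[i0 ij] _; apply: zeta_le_succ H dt0 i0 _.
  exact: leq_ltn_trans ij.
move=> {kN}k kN; have /andP[k0 kN'] := kN.
have [r [Lr rC] eqr] := error_equation T0 S0 H fL2 uH hu hU kN C0 (RC k kN).
have jT j : (j <= N)%N -> 0 <= j%:R * dt <= T.
  move=> jN; apply/andP; split; first by apply: mulr_ge0 => //; exact: ltW.
  by rewrite /dt mulrCA ger_pMr// ler_pdivrMr// mul1r ler_nat.
have He j : (0 < j <= N)%N -> H10 S (e j).
  move=> jN; apply: H10B; last by case: hU => _ h _ _; exact: h.
  by case/andP: jN => _ /jT /uH[].
have Le j : (0 < j <= N)%N -> L2 S (e j) by move=> /He[[]].
set E := fun j => norm1 S (kappa n d a dt) (e j).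
set B := (X in _ <= X).
change (E k <= B).
have Ej0 j : 0 <= E j by exact: sqrtr_ge0.
have zj j : j \in index_iota 1 k ->
    0 <= zeta n d a dt j.+1 k - zeta n d a dt j k.
  by rewrite mem_index_iota => /andP[j0 _]; rewrite subr_ge0 (zeta_le_succ H dt0).
have B0 : 0 <= B.
  rewrite addr_ge0 ?mulr_ge0 ?sqrtr_ge0// big_seq sumr_ge0// => j /zj z0.
  exact: mulr_ge0 z0 (Ej0 j).
have nE j : norm0 S (e j) <= E j by exact: norm0_le_norm1 (ltW kap0).
(* The error equation is tested with [e k] itself: its left side becomes the squared norm, and
   Cauchy-Schwarz with [nE] bounds the right side. *)
have : E k ^+ 2 <= B * E k.
  rewrite norm1_sqr ?(ltW kap0)// (eqr _ (He k kN)) /B mulrDl; apply: lerD.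
    rewrite big_distrl/= big_seq [leRHS]big_seq; apply: ler_sum => j jk.
    rewrite -mulrA ler_wpM2l ?zj//.
    have jN : (0 < j <= N)%N.
      by move: jk; rewrite mem_index_iota => /andP[-> /ltnW jk]; exact: leq_trans kN'.
    apply: le_trans (ler_norm _) _.
    apply: le_trans (ip_cauchy_schwarz (Le j jN) (Le k kN)) _.
    by apply: ler_pM => //; exact: norm0_ge0.
  apply: le_trans (ler_norm _) _; rewrite normrN.
  apply: le_trans (ip_cauchy_schwarz Lr (Le k kN)) _.
  by apply: ler_pM => //; exact: norm0_ge0.
(* Division by [E k] requires it to be nonzero; otherwise [B0] suffices. *)
have [-> _|Ek0] := eqVneq (E k) 0; first exact: B0.
by rewrite expr2 ler_pM2r// lt_neqAle eq_sym Ek0 Ej0.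
Qed.

Lemma monotone_admissible_data (R : realType) (n : nat) (d a : nat -> R) :
  (forall i, (1 <= i <= n)%N -> 0 <= d i) ->
  (exists2 i, (1 <= i <= n)%N & d i != 0) ->
  0 < a 1%N -> (forall i, (1 <= i < n)%N -> a i <= a i.+1) -> a n < 1 ->
  admissible_data n d a (a n).
Proof.
move=> d0 [m nm dm] a1 ha an.
have mono i j : (1 <= i)%N -> (i <= j <= n)%N -> a i <= a j.
  move=> i1 /andP[]; elim: j => [|j IH]; first by rewrite leqn0 => /eqP ->.
  rewrite leq_eqVlt => /predU1P[->//|ij jn].
  apply: le_trans (IH ij (ltnW jn)) (ha _ _).
  by rewrite jn (leq_trans i1).
split=> //.
- by exists m => //; rewrite lt_neqAle eq_sym dm d0.
- move=> j /andP[j1]; rewrite ltnS => jn; apply/andP; split.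
    by apply: lt_le_trans a1 (mono _ _ _ _); rewrite ?j1.
  by apply: mono; rewrite ?jn ?leqnn.
Qed.

Theorem theorem2p3 (R : realType) (T S : R) (hT : 0 < T) (hS : 0 < S)
  (n : nat) (hn : (1 <= n)%N) (hn1 : n <> 1%N)
  (d : nat -> R)
  (hd : forall i, (1 <= i <= n)%N -> 0 <= d i)
  (hd0 : exists2 i, (1 <= i <= n)%N & d i != 0)
  (a : nat -> R)
  (ha0 : 0 < a 1%N)
  (ha : forall i, (1 <= i < n)%N -> a i <= a i.+1)
  (ha1 : a n < 1)
  (f : R -> R -> R) (hf : forall t, 0 <= t <= T -> L2 S (f ^~ t))
  (phi : R -> R) (hphi : L2 S phi)
  (u : R -> R -> R)
  (hsm : smooth_solution T S u)
  (hu : exact_solution T S n d a f phi u)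
  (U : nat -> nat -> R -> R)
  (hU : forall N, (1 <= N)%N -> semidiscrete_solution T S n d a f phi N (U N)) :
  exists c : R, 0 < c /\
    forall N, (1 <= N)%N -> forall k, (1 <= k <= N)%N ->
      let dt := T / N%:R in
      (forall x, dom S x -> `|Rtilde n d a dt u k x| <= c * dt ^+ 2) /\
      norm1 S (kappa n d a dt) (fun x => u x (k%:R * dt) - U N k x)
        <= c * S * expR (a n * T / (1 - a n)) * dt ^+ 2.
Proof.
have H := monotone_admissible_data hd hd0 ha0 ha ha1.
have [uC2 [M uM] uH] := hsm.
(* The absolute value makes the bound on the second time derivative visibly nonnegative. *)
set c0 := (1 + T) * (T * `|M| * (1 - a n)^-1 ^+ 2).
have T0 := ltW hT.
have c00 : 0 <= c0.
  apply: mulr_ge0; first exact: addr_ge0.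
  apply: mulr_ge0; last exact: sqr_ge0.
  exact: mulr_ge0.
have s0 : 0 < Num.sqrt S by rewrite sqrtr_gt0.
(* One constant must serve both estimates: [c >= c0] for the truncation error, and
   [c * S >= c0 * Num.sqrt S] because the residual bound produces [Num.sqrt S] where the claim has
   [S]. The [+ 1] ensures positivity. *)
set c := (c0 + 1) * (1 + (Num.sqrt S)^-1).
have c_gt0 : 0 < c by rewrite mulr_gt0// ltr_wpDl// ?invr_ge0 ?ltW.
have c0c : c0 <= c.
  apply: (@le_trans _ _ (c0 + 1)); first by rewrite lerDl.
  by rewrite ler_peMr ?addr_ge0// lerDl invr_ge0 ltW.
have c0S : c0 * Num.sqrt S <= c * S.
  rewrite -[S in leRHS](sqr_sqrtr (ltW hS)) /c expr2.
  have -> : (c0 + 1) * (1 + (Num.sqrt S)^-1) * (Num.sqrt S * Num.sqrt S) =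
      (c0 + 1) * (1 + Num.sqrt S) * Num.sqrt S by field; rewrite gt_eqF.
  apply: ler_wpM2r; first exact: ltW.
  apply: (@le_trans _ _ (c0 + 1)); first by rewrite lerDl.
  by rewrite ler_peMr ?addr_ge0// lerDl ltW.
exists c; split=> // N N1 k kN dt.
have N0 : (0 : R) < N%:R by rewrite ltr0n.
have dt0 : 0 < dt by rewrite divr_gt0.
have jT j : (j <= N)%N -> j%:R * dt <= T.
  by move=> jN; rewrite /dt mulrCA ger_pMr// ler_pdivrMr// mul1r ler_nat.
have Rc j : (0 < j <= N)%N -> forall x, dom S x ->
    `|Rtilde n d a dt u j x| <= c0 * dt ^+ 2.
  move=> /andP[j0 jN] x Sx; apply: (Rtilde_bound H) => //; [exact: jT|exact: uC2|].
  by move=> t tT; apply: le_trans (ler_norm M); exact: uM.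
have dt2 : 0 <= dt ^+ 2 by exact: sqr_ge0.
split.
  by move=> x Sx; apply: le_trans (Rc k kN x Sx) _; rewrite ler_wpM2r.
have C0 : 0 <= c0 * dt ^+ 2 by exact: mulr_ge0.
apply: le_trans (error_bound hT (ltW hS) H hf uH hu (hU N N1) C0 Rc kN) _.
have /andP[k0 kN'] := kN.
have ez : (zeta n d a dt 1 k)^-1 <= expR (a n * T / (1 - a n)).
  rewrite -[leRHS]invrK -expRN lef_pV2 ?posrE ?expR_gt0 ?(zeta1_gt0 H dt0)//.
  by apply: (zeta1_ge H) => //; exact: jT.
have -> : c0 * dt ^+ 2 * Num.sqrt S / zeta n d a dt 1 k =
    c0 * Num.sqrt S * (zeta n d a dt 1 k)^-1 * dt ^+ 2 by ring.
rewrite ler_wpM2r//; apply: ler_pM => //.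
  by rewrite mulr_ge0// ltW.
by rewrite invr_ge0 ltW// (zeta1_gt0 H dt0).
Qed.
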